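(* The kernel $K=\mathrm{Ker}(\overline A(y))$ of $\overline A(y)$ does not depend on $y\in\mathbb R^d$. For each $y\in\mathbb R^d$, $\overline B(y)\in K^\perp$ (the orthogonal complement of $K$), and there exists a constant $\alpha>0$ such that $$\forall y\in\mathbb R^d,\ \forall x\in K^\perp,\qquad \alpha^{-1}|x|^2\le\langle x,\overline A(y)x\rangle\le\alpha|x|^2 .$$ In other words, for each starting point $x\in\mathbb R^d$, the process $X$ solving $X_t=x+\int_0^t\overline B(X_r)dr+\int_0^t\overline A^{1/2}(X_r)dB_r$ can be seen as the solution of an SDE defined on $x+K^\perp$ with a uniformly elliptic diffusion matrix $\overline A$.
   Context: RANDOM MEDIUM. $d\ge1$. $(\Omega,\mathcal G,\mu)$ is a probability space and $\{\tau_x;x\in\mathbb R^d\}$ a group of $\mu$-preserving transformations of $\Omega$ acting ergodically (if $\tau_xA=A$ for all $x$ then $\mu(A)\in\{0,1\}$), such that $(x,\omega)\mapsto g(\tau_x\omega)$ is measurable for every measurable $g$. $\mathbb M$ is the expectation under $\mu$; $|\cdot|_2$, $(\cdot,\cdot)_2$ are the norm and inner product of $L^2(\Omega)$. $D_i$ is the generator of $h\mapsto g(\tau_{he_i}\cdot)$ in $L^2(\Omega)$, $D=(D_1,\dots,D_d)^*$. $\mathcal C=\mathrm{Span}\{\omega\mapsto\int_{\mathbb R^d}g(\tau_x\omega)\varphi(x)\,dx;\ g\in L^\infty(\Omega),\varphi\in C_c^\infty(\mathbb R^d)\}$, dense in $L^2(\Omega)$. A measurable $f$ on $\Omega\times\mathbb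 R^d$ defines the locally stationary field $f(\omega,x,y)=f(\tau_x\omega,y)$; a measurable function on $\Omega$ defines a stationary field likewise. COEFFICIENTS. $\sigma,H:\Omega\times\mathbb R^d\to\mathbb R^{d\times d}$, $\tilde\sigma:\Omega\to\mathbb R^{d\times d}$, $V:\mathbb R^d\to\mathbb R$ are measurable, $H$ is antisymmetric, $a=\sigma\sigma^*$, $\tilde a=\tilde\sigma\tilde\sigma^*$. Standing assumptions, for constants $\Lambda,M>0$: (1) Regularity: for each $\omega$, $\sigma(\omega,\cdot,\cdot)$, $H(\omega,\cdot,\cdot)$, $\tilde\sigma(\omega,\cdot)$ are twice continuously differentiable in each variable and, with their derivatives up to order two, are $\Lambda$-Lipschitz and bounded by $\Lambda$; $V$ is $C^3$, is $\Lambda$-Lipschitz, and its derivatives of orders one to three are bounded by $\Lambda$ and $\Lambda$-Lipschitz. (2) Control: $M^{-1}\tilde a(\omega)\le a(\omega,y)\le M\tilde a(\omega)$ for all $(\omega,y)$; for each $\omega$ and $i,j$ the functions $y\mapsto\partial_{y_i}a,\ \partial^2_{y_iy_j}a,\ H,\ \partial_{y_i}H,\ \partial^2_{y_iy_j}H$ at $(\omega,y)$ are $(M,\tilde a(\omega))$-controlled, where $g:\mathbb R^d\to\mathbb R^{d\times d}$ is $(C,A)$-controlled if $|g(y)|\le CA$ and $|g(y)-g(y')|\le CA|y-y'|$ for all $y,y'$, with $|N|=(NN^* )^{1/2}$ and $\le$ the order of symmetric matrices; moreover $|\sigma(\omega,y+h)-\sigma(\omega,y)|^2\le M\tilde a(\omega)|h|^2$,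 and $\int_{\mathbb R^d}e^{-2V(y)}dy=1$. (3) Ergodicity: the Friedrichs extension $\tilde S$ of $\frac12\sum_{i,j}D_i(\tilde a_{ij}D_j)$ defined on $\mathcal C\subset L^2(\Omega)$ generates an ergodic semigroup, i.e. its invariant functions are $\mu$-a.s. constant. AUXILIARY PROBLEMS. $b_j(\omega,y)=\frac12\sum_iD_i(a+H)_{ij}(\omega,y)$. $(\varphi,\psi)_1=\frac12(\tilde aD\varphi,D\psi)_2$ and $\|\varphi\|_1^2=(\varphi,\varphi)_1$ on $\mathcal C$; $\mathbb H_1\subset L^2(\Omega)$ is the closure of $\mathcal C$ for $(|\varphi|_2^2+\|\varphi\|_1^2)^{1/2}$. For fixed $y$, $\mathcal B^L(\varphi,\psi)=\frac12((a+H)(\cdot,y)D\varphi,D\psi)_2$ extends continuously from $\mathcal C\times\mathcal C$ to $\mathbb H_1\times\mathbb H_1$. $L^y$ (formally $\frac12\sum_{i,j}D_i((a+H)_{ij}(\cdot,y)D_j\cdot)$) is the operator with domain the set of $\varphi\in\mathbb H_1$ for which there is $g\in L^2(\Omega)$ with $\mathcal B^L(\varphi,\psi)=-(g,\psi)_2$ for all $\psi\in\mathbb H_1$, and then $L^y\varphi=g$. For $\lambda>0$, $u^i_\lambda(\cdot,y)$ is the unique element of $\mathbb H_1\cap\mathrm{Dom}(L^y)$ with $\lambda u^i_\lambda(\cdot,y)-L^yu^i_\lambda(\cdot,y)=b_i(\cdot,y)$. HOMOGENIZED COEFFICIENTS. $$\overline A(y)=\lim_{\lambda\to0}\mathbb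 M[(I+Du_\lambda)^*a(I+Du_\lambda)(\cdot,y)],\quad \overline H(y)=\lim_{\lambda\to0}\mathbb M[(I+Du_\lambda)^*H(I+Du_\lambda)(\cdot,y)],$$ $$\overline B_j(y)=\tfrac12e^{2V(y)}\sum_{i}\partial_{y_i}(e^{-2V}[\overline A+\overline H]_{ij})(y).$$ Meaning of the formulae: for $x,x'\in\mathbb R^d$ and $G\in\{a,H\}$, the map $(\varphi,\psi)\mapsto\mathbb M[(x+D\varphi)^*G(\cdot,y)(x'+D\psi)]$ on $\mathcal C\times\mathcal C$ extends continuously to $\mathbb H_1\times\mathbb H_1$ (because $G$ is controlled by $\tilde a$); the $(i,j)$ entry of $\mathbb M[(I+Du_\lambda)^*G(I+Du_\lambda)(\cdot,y)]$ denotes this extension evaluated at $x=e_i$, $x'=e_j$, $\varphi=u^i_\lambda(\cdot,y)$, $\psi=u^j_\lambda(\cdot,y)$. $B$ is a standard $d$-dimensional Brownian motion. *)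

(* Defs.v *)
From HB Require Import structures.
From mathcomp Require Import all_boot all_order all_algebra.
From mathcomp Require Import all_classical all_reals all_analysis.

Set Implicit Arguments.
Unset Strict Implicit.
Unset Printing Implicit Defensive.

Import Order.TTheory GRing.Theory Num.Theory.
Import numFieldNormedType.Exports.

Local Open Scope classical_set_scope.
Local Open Scope ring_scope.

(* Elements of R^d are column vectors 'cV[R]_d; their Euclidean norm is enorm.
   The library norm `|N| of a matrix N is the largest absolute value of an
   entry. *)

Section euclidean.
Context {R : realType}.
Implicit Types d : nat.

Definition dotc d (x y : 'cV[R]_d) : R := (x^T *m y) ord0 ord0.

Definition enorm d (x : 'cV[R]_d) : R := Num.sqrt (dotc x x).

Definition evec d (i : 'I_d) : 'cV[R]_d := delta_mx i ord0.

Definition orthc d (K : set 'cV[R]_d) : set 'cV[R]_d :=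
  [set x | forall k, K k -> dotc x k = 0].

Definition kerc d (A : 'M[R]_d) : set 'cV[R]_d := [set x | A *m x = 0].

(* Used between symmetric matrices only. *)
Definition mxle d (A B : 'M[R]_d) : Prop :=
  forall x : 'cV[R]_d, dotc x (A *m x) <= dotc x (B *m x).

(* S is the symmetric nonnegative square root of A. *)
Definition is_sqrtmx d (A S : 'M[R]_d) : Prop :=
  [/\ S^T = S, forall x : 'cV[R]_d, 0 <= dotc x (S *m x) & S *m S = A].

(* |N| <= A, where |N| = (N N^* )^(1/2). *)
Definition absmx_le d (N A : 'M[R]_d) : Prop :=
  exists2 S, is_sqrtmx (N *m N^T) S & mxle S A.

Definition controlled d (C : R) (A : 'M[R]_d) (g : 'cV[R]_d -> 'M[R]_d) : Prop :=
  (forall y, absmx_le (g y) (C *: A)) /\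
  (forall y y', absmx_le (g y - g y') ((C * enorm (y - y')) *: A)).

End euclidean.

Section borel_matrix.
Context {R : realType}.
Variables m n : nat.

Definition mx_coord_preimages : set (set 'M[R]_(m, n)) :=
  [set A | exists i j (B : set R), measurable B /\
    A = (fun N : 'M[R]_(m, n) => N i j) @^-1` B].

Let mx_set0 : <<s mx_coord_preimages >> set0.
Proof. exact: sigma_algebra0. Qed.

Let mx_setC A : <<s mx_coord_preimages >> A -> <<s mx_coord_preimages >> (~` A).
Proof. exact: sigma_algebraC. Qed.

Let mx_bigcup (F : _^nat) : (forall i, <<s mx_coord_preimages >> (F i)) ->
  <<s mx_coord_preimages >> (\bigcup_i (F i)).
Proof. exact: sigma_algebra_bigcup. Qed.

(* The Borel sigma-algebra of R^(m x n). *)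
HB.instance Definition _ := @isMeasurable.Build
  (sigma_display mx_coord_preimages) 'M[R]_(m, n)
  (<<s mx_coord_preimages >>) mx_set0 mx_setC mx_bigcup.

End borel_matrix.

(* Lebesgue measure on R^d, as the iterated product of one-dimensional
   Lebesgue measures: the measure of A is the integral over the first
   coordinate t of the measure of the section of A at t. *)
Fixpoint lebesgued {R : realType} (d : nat) : set 'cV[R]_d -> \bar R :=
  match d return set 'cV[R]_d -> \bar R with
  | 0 => fun A => \d_(0 : 'cV[R]_0) A
  | d'.+1 => fun A => (\int[lebesgue_measure]_(t in [set: R])
      lebesgued [set v : 'cV[R]_d' | A (col_mx (t%:M : 'cV[R]_1) v)])%E
  end.

Section differentiability.
Context {R : realType} {d : nat} {W : normedModType R}.
Implicit Types f : 'cV[R]_d -> W.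

(* The iterated partial derivative along the coordinates listed in s. *)
Definition iterD (s : seq 'I_d) f : 'cV[R]_d -> W :=
  foldr (fun i g y => 'D_(evec i) g y) f s.

Definition Ck (k : nat) f : Prop :=
  (forall s, (size s <= k)%N -> continuous (iterD s f)) /\
  (forall s i y, (size s < k)%N -> derivable (iterD s f) y (evec i)).

Definition bounded_by (L : R) f : Prop := forall y, `|f y| <= L.

Definition lipschitz_by (L : R) f : Prop :=
  forall y y', `|f y - f y'| <= L * enorm (y - y').

Definition regular (L : R) f : Prop :=
  Ck 2 f /\
  forall s, (size s <= 2)%N -> bounded_by L (iterD s f) /\ lipschitz_by L (iterD s f).

(* Regularity of (x, y) |-> F x y on R^d x R^d in each of its two variables;
   the derivatives are bounded and Lipschitz as functions of the pair. *)
Definition regular2 (L : R) (F : 'cV[R]_d -> 'cV[R]_d -> W) : Prop :=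
  let ok (G : 'cV[R]_d -> 'cV[R]_d -> W) :=
    (forall x y, `|G x y| <= L) /\
    (forall x y x' y', `|G x y - G x' y'| <=
       L * Num.sqrt (enorm (x - x') ^+ 2 + enorm (y - y') ^+ 2)) in
  [/\ forall y, Ck 2 (F ^~ y),
      forall x, Ck 2 (F x),
      forall s, (size s <= 2)%N -> ok (fun x y => iterD s (F ^~ y) x)
    & forall s, (size s <= 2)%N -> ok (fun x y => iterD s (F x) y)].

Definition potential (L : R) (V : 'cV[R]_d -> W) : Prop :=
  [/\ Ck 3 V,
      forall s, (0 < size s <= 3)%N -> bounded_by L (iterD s V)
    & forall s, (size s <= 3)%N -> lipschitz_by L (iterD s V)].

Definition test_function f : Prop :=
  (forall k, Ck k f) /\ compact (closure [set x | f x != 0]).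

End differentiability.

Section medium.
Context {R : realType} {d : nat} {dO : measure_display}
  {Om : measurableType dO}.
Variables (mu : probability Om R) (tau : 'cV[R]_d -> Om -> Om).
Implicit Types (f g phi psi : Om -> R) (Phi Psi : Om -> 'cV[R]_d).

Definition random_medium : Prop :=
  [/\ (forall w, tau 0 w = w) /\
      (forall x y w, tau (x + y) w = tau x (tau y w)),
      forall x, measurable_fun [set: Om] (tau x) /\
        forall A, measurable A -> mu (tau x @^-1` A) = mu A,
      forall A, measurable A -> (forall x, tau x @` A = A) ->
        mu A = 0%E \/ mu A = 1%E
    & forall g : Om -> R, measurable_fun [set: Om] g ->
        measurable_fun [set: 'cV[R]_d * Om] (fun p => g (tau p.1 p.2))].

Definition L2 : set (Om -> R) := [set f | f \in Lfun mu 2%:E].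

Definition dot2 f g : R := \int[mu]_w (f w * g w).

Definition norm2 f : R := Num.sqrt (dot2 f f).

(* The span C of the smoothed bounded functions. *)
Definition core : set (Om -> R) := [set phi |
  exists n (c : 'I_n -> R) (g : 'I_n -> Om -> R) (h : 'I_n -> 'cV[R]_d -> R),
    (forall k, g k \in Lfun mu +oo%E /\ test_function (h k)) /\
    phi = fun w => \sum_(k < n) c k *
      fine (\int[lebesgued (R:=R) (d:=d)]_(x in [set: 'cV[R]_d])
              (g k (tau x w) * h k x)%:E)%E].

(* f is in the domain of D_i and D_i f = g; functions represent their
   classes modulo mu-a.e. equality. *)
Definition is_D (i : 'I_d) f g : Prop :=
  [/\ L2 f, L2 g &
    norm2 (fun w => h^-1 * (f (tau (h *: evec i) w) - f w) - g w)
      @[h --> (0 : R)^'] --> (0 : R)].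

Definition is_grad phi Phi : Prop :=
  forall i, is_D i phi (fun w => Phi w i ord0).

Section forms.
Variables (sigma H : Om -> 'cV[R]_d -> 'M[R]_d) (sigmat : Om -> 'M[R]_d).

Definition amx w y : 'M[R]_d := sigma w y *m (sigma w y)^T.

Definition atmx w : 'M[R]_d := sigmat w *m (sigmat w)^T.

(* The form (phi, psi)_1, in terms of the gradients Phi, Psi. *)
Definition form1 Phi Psi : R :=
  2^-1 * \int[mu]_w dotc (atmx w *m Phi w) (Psi w).

(* (f, F) is a sequence of C, with its gradients, which is Cauchy for |.|_1
   and converges to phi in L^2. *)
Definition approx phi (f : nat -> Om -> R) (F : nat -> Om -> 'cV[R]_d) : Prop :=
  [/\ forall n, core (f n) /\ is_grad (f n) (F n),
      norm2 (f n \- phi) @[n --> \oo] --> (0 : R)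
    & forall e : R, 0 < e -> exists N, forall m n, (N <= m)%N -> (N <= n)%N ->
        form1 (F m \- F n) (F m \- F n) < e].

Definition H1 : set (Om -> R) := [set phi |
  L2 phi /\ exists (f : nat -> Om -> R) (F : nat -> Om -> 'cV[R]_d), approx phi f F].

(* l is the value at (phi, psi) of the continuous extension to H1 x H1 of the
   map (phi, psi) |-> q (D phi) (D psi) defined on C x C. *)
Definition ext_value (q : (Om -> 'cV[R]_d) -> (Om -> 'cV[R]_d) -> R)
    phi psi (l : R) : Prop :=
  forall (f g : nat -> Om -> R) (F G : nat -> Om -> 'cV[R]_d),
    approx phi f F -> approx psi g G -> q (F n) (G n) @[n --> \oo] --> l.

(* The operator associated with the closure of (phi, psi)_1, i.e. of
   - (S0 phi, psi)_2 on C, where S0 = 1/2 sum_ij D_i (at_ij D_j). *)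
Definition friedrichs phi g : Prop :=
  [/\ H1 phi, L2 g &
    forall psi, H1 psi -> ext_value form1 phi psi (- dot2 g psi)].

Definition contraction_semigroup (P : R -> (Om -> R) -> Om -> R) : Prop :=
  [/\ forall t f, 0 <= t -> L2 f -> L2 (P t f) /\ norm2 (P t f) <= norm2 f,
      forall t (c : R) f g, 0 <= t -> L2 f -> L2 g ->
        \forall w \ae mu,
          P t (fun w' => c * f w' + g w') w = c * P t f w + P t g w,
      forall f, L2 f -> \forall w \ae mu, P 0 f w = f w,
      forall s t f, 0 <= s -> 0 <= t -> L2 f ->
        \forall w \ae mu, P (s + t) f w = P s (P t f) w
    & forall f, L2 f -> norm2 (P t f \- f) @[t --> (0 : R)^'+] --> (0 : R)].

Definition generated_by (P : R -> (Om -> R) -> Om -> R)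
    (A : (Om -> R) -> (Om -> R) -> Prop) : Prop :=
  forall f g, L2 f -> L2 g ->
    (A f g <->
     norm2 (fun w => t^-1 * (P t f w - f w) - g w) @[t --> (0 : R)^'+]
       --> (0 : R)).

Definition ergodic_form : Prop :=
  exists P, [/\ contraction_semigroup P, generated_by P friedrichs &
    forall f, L2 f -> (forall t, 0 <= t -> \forall w \ae mu, P t f w = f w) ->
      exists c : R, \forall w \ae mu, f w = c].

Definition measurable_coefficients (V : 'cV[R]_d -> R) : Prop :=
  [/\ measurable_fun [set: Om * 'cV[R]_d] (fun p => sigma p.1 p.2),
      measurable_fun [set: Om * 'cV[R]_d] (fun p => H p.1 p.2),
      measurable_fun [set: Om] sigmat &
      measurable_fun [set: 'cV[R]_d] V].

Definition regularity (Lam : R) (V : 'cV[R]_d -> R) : Prop :=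
  (forall w, [/\ regular2 Lam (fun x y => sigma (tau x w) y),
                 regular2 Lam (fun x y => H (tau x w) y)
               & regular Lam (fun x => sigmat (tau x w))]) /\
  potential Lam V.

Definition control (M : R) (V : 'cV[R]_d -> R) : Prop :=
  [/\ forall w y, mxle (M^-1 *: atmx w) (amx w y) /\
                  mxle (amx w y) (M *: atmx w),
      forall w s, (0 < size s <= 2)%N ->
        controlled M (atmx w) (iterD s (amx w)),
      forall w s, (size s <= 2)%N -> controlled M (atmx w) (iterD s (H w)),
      forall w y h,
        mxle ((sigma w (y + h) - sigma w y) *m (sigma w (y + h) - sigma w y)^T)
             ((M * enorm h ^+ 2) *: atmx w)
    & (\int[lebesgued (R:=R) (d:=d)]_(y in [set: 'cV[R]_d])
         (expR (- 2 * V y))%:E)%E = 1%E].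

(* b = b_j(., y) *)
Definition is_b (y : 'cV[R]_d) (j : 'I_d) (b : Om -> R) : Prop :=
  exists g : 'I_d -> Om -> R,
    (forall i, is_D i (fun w => (amx w y + H w y) i j) (g i)) /\
    b = fun w => 2^-1 * \sum_(i < d) g i w.

Definition formBL (y : 'cV[R]_d) Phi Psi : R :=
  2^-1 * \int[mu]_w dotc ((amx w y + H w y) *m Phi w) (Psi w).

Definition is_L (y : 'cV[R]_d) phi g : Prop :=
  [/\ H1 phi, L2 g &
    forall psi, H1 psi -> ext_value (formBL y) phi psi (- dot2 g psi)].

(* u = u^i_lam(., y) *)
Definition corrector (lam : R) (i : 'I_d) (y : 'cV[R]_d) (u : Om -> R) : Prop :=
  exists g b, [/\ is_L y u g, is_b y i b &
    \forall w \ae mu, lam * u w - g w = b w].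

Definition formG (G : Om -> 'M[R]_d) (x x' : 'cV[R]_d) Phi Psi : R :=
  \int[mu]_w dotc (x + Phi w) (G w *m (x' + Psi w)).

(* GG y = lim_(lam -> 0) M[(I + Du_lam)^* G (I + Du_lam) (., y)], entrywise. *)
Definition homogenized (u : R -> 'I_d -> 'cV[R]_d -> Om -> R)
    (G : Om -> 'cV[R]_d -> 'M[R]_d) (GG : 'cV[R]_d -> 'M[R]_d) : Prop :=
  forall y i j, exists E : R -> R,
    (forall lam, 0 < lam ->
       ext_value (formG (G ^~ y) (evec i) (evec j)) (u lam i y) (u lam j y)
         (E lam)) /\
    E lam @[lam --> (0 : R)^'+] --> GG y i j.

End forms.

(* The formula for the drift requires the partial derivatives in it to exist:
   'D_v has an arbitrary value otherwise. *)
Definition homogenized_drift (V : 'cV[R]_d -> R)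
    (Abar Hbar : 'cV[R]_d -> 'M[R]_d) (Bbar : 'cV[R]_d -> 'cV[R]_d) : Prop :=
  let c i j z : R := expR (- 2 * V z) * (Abar z + Hbar z) i j in
  (forall y i j, derivable (c i j) y (evec i)) /\
  (forall y j, Bbar y j ord0 =
     2^-1 * expR (2 * V y) * \sum_(i < d) 'D_(evec i) (c i j) y).

End medium.

Section sde.
Context {R : realType} {d : nat} {dT : measure_display} {T : measurableType dT}.
Variables (P : probability T R) (Ft : R -> set (set T)).

Definition filtration : Prop :=
  [/\ forall t, 0 <= t -> sigma_algebra [set: T] (Ft t),
      forall t, 0 <= t -> Ft t `<=` measurable
    & forall s t, 0 <= s -> s <= t -> Ft s `<=` Ft t].

Definition adapted m n (Z : R -> T -> 'M[R]_(m, n)) : Prop :=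
  forall t i j (U : set R), 0 <= t -> measurable U ->
    Ft t ((fun w => Z t w i j) @^-1` U).

Definition continuous_paths m n (Z : R -> T -> 'M[R]_(m, n)) : Prop :=
  \forall w \ae P, {within [set t : R | 0 <= t], continuous (fun t => Z t w)}.

(* Standard Brownian motion for the filtration Ft: W_t - W_s is independent
   of Ft s, with independent coordinates of law N(0, t - s); the second
   parameter of normal_prob is the standard deviation. *)
Definition brownian (W : R -> T -> 'cV[R]_d) : Prop :=
  [/\ adapted W,
      continuous_paths W,
      \forall w \ae P, W 0 w = 0
    & forall s t A (U : 'I_d -> set R), 0 <= s -> s < t -> Ft s A ->
        (forall i, measurable (U i)) ->
        P (A `&` [set w | forall i, U i ((W t w - W s w) i ord0)]) =
        (P A * \prod_(i < d) normal_prob 0%R (Num.sqrt (t - s)%R) (U i))%E].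

(* sum of Z_(t_k) (W_(t_(k+1)) - W_(t_k)) along the points r :: s *)
Fixpoint ito_sum (Z : R -> T -> 'M[R]_d) (W : R -> T -> 'cV[R]_d)
    (r : R) (s : seq R) (w : T) : 'cV[R]_d :=
  if s is r' :: s' then
    Z r w *m (W r' w - W r w) + ito_sum Z W r' s' w
  else 0.

(* I_t is the Ito integral over [0, t] of Z against W, for a continuous
   adapted integrand Z: the limit in probability of the left-point Riemann
   sums as the mesh of the partition of [0, t] goes to 0. *)
Definition ito_integral (W : R -> T -> 'cV[R]_d) (Z : R -> T -> 'M[R]_d)
    (I : R -> T -> 'cV[R]_d) : Prop :=
  [/\ adapted Z /\ continuous_paths Z,
      adapted I /\ continuous_paths I
    & forall t e eta : R, 0 <= t -> 0 < e -> 0 < eta ->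
        exists2 delta : R, 0 < delta & forall s,
          itv_partition 0 t s -> path (fun r r' => r' - r < delta) 0 s ->
          (P [set w | (e < enorm (I t w - ito_sum Z W 0 s w))%R] <= eta%:E)%E].

(* dX = B(X) dt + S(X) dW, X_0 = x *)
Definition sde_solution (W : R -> T -> 'cV[R]_d) (B : 'cV[R]_d -> 'cV[R]_d)
    (S : 'cV[R]_d -> 'M[R]_d) (x : 'cV[R]_d) (X : R -> T -> 'cV[R]_d) : Prop :=
  [/\ adapted X, continuous_paths X &
    exists I, ito_integral W (fun t w => S (X t w)) I /\
      \forall w \ae P, forall t : R, 0 <= t ->
        (forall i, lebesgue_measure.-integrable `[0, t]
           (EFin \o (fun r : R => B (X r w) i ord0))) /\
        X t w = x + \col_i (\int[lebesgue_measure]_(r in `[0, t])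
                              B (X r w) i ord0) + I t w].

End sde.

(* Main.v *)
(* For x in R^d put xi = x + Du, where u is the combination of the correctors
   u^i_lam(., y) with the coordinates of x.  Testing the corrector equation
   against u - phi, with phi in C, and using that a and H are controlled by
   a~, one gets (a xi, xi)_2 <= 4 M^3 (a~ zeta, zeta)_2 + O(lam) for
   zeta = x + D phi, so that <x, Abar(y) x> <= 4 M^3 (a~ zeta, zeta)_2.
   Applying this to the approximations phi of the correctors at another point
   y', and a~ <= M a(., y'), yields <x, Abar(y) x> <= 4 M^4 <x, Abar(y') x>:
   all the forms Abar(y) are comparable, hence have the same kernel K and are
   uniformly elliptic on its complement.  Young's inequality also gives
   2 <x, Hbar x'> <= M^2 (t <x, Abar x> + t^-1 <x', Abar x'>) for all t > 0, so
   Hbar vanishes on K, and differentiating (Abar + Hbar) k = 0 shows that Bbar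
   is orthogonal to K.  Finally, the left-point sums defining the stochastic
   integral are orthogonal to K, and so is their limit. *)

Require Import Defs.
From mathcomp Require Import all_boot all_order all_algebra.
From mathcomp Require Import all_classical all_reals all_analysis.
From mathcomp Require Import measurable_realfun ring lra.

Import Order.TTheory GRing.Theory Num.Theory.
Import numFieldNormedType.Exports.

Set Implicit Arguments.
Unset Strict Implicit.
Unset Printing Implicit Defensive.

Local Open Scope classical_set_scope.
Local Open Scope ring_scope.

(** * Quadratic forms and absolute values of matrices *)

(** Taking [t = e / (|c| + 1)] makes [t * c] at most [e], whatever the sign of [c]. This replaces
    passages to the limit [t -> 0] in the Young-type arguments below. *)
Lemma ler_small (R : realFieldType) (a b c : R) :
  (forall t, 0 < t -> a <= b + t * c) -> a <= b.
Proof.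
move=> h; apply/ler_addgt0Pr => e e0.
have c0 : 0 < `|c| + 1 by rewrite ltr_wpDl.
have := h (e / (`|c| + 1)) (divr_gt0 e0 c0).
move=> /le_trans; apply; rewrite lerD2l mulrAC ler_pdivrMr//.
by apply: ler_wpM2l; [exact: ltW | rewrite (le_trans (ler_norm c))// lerDl].
Qed.

Section euclidean.
Context {R : realType} {d : nat}.
Implicit Types (x y z : 'cV[R]_d) (A S N : 'M[R]_d) (K : set 'cV[R]_d).

Lemma dotcE x y : dotc x y = \sum_i x i ord0 * y i ord0.
Proof. by rewrite /dotc mxE; apply: eq_bigr => i _; rewrite mxE. Qed.

Lemma dotcC x y : dotc x y = dotc y x.
Proof. by rewrite !dotcE; apply: eq_bigr => i _; rewrite mulrC. Qed.

Lemma dotcDl x y z : dotc (x + y) z = dotc x z + dotc y z.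
Proof. by rewrite /dotc linearD mulmxDl mxE. Qed.

Lemma dotcZl t x y : dotc (t *: x) y = t * dotc x y.
Proof. by rewrite /dotc linearZ -scalemxAl mxE. Qed.

Lemma dotcDr x y z : dotc z (x + y) = dotc z x + dotc z y.
Proof. by rewrite /dotc mulmxDr mxE. Qed.

Lemma dotcZr t x y : dotc x (t *: y) = t * dotc x y.
Proof. by rewrite /dotc -scalemxAr mxE. Qed.

Lemma dotcNl x y : dotc (- x) y = - dotc x y.
Proof. by rewrite -scaleN1r dotcZl mulN1r. Qed.

Lemma dotcNr x y : dotc x (- y) = - dotc x y.
Proof. by rewrite dotcC dotcNl dotcC. Qed.

Lemma dotc0l x : dotc 0 x = 0.
Proof. by rewrite -(scale0r 0) dotcZl mul0r. Qed.

Lemma dotc0r x : dotc x 0 = 0.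
Proof. by rewrite dotcC dotc0l. Qed.

Lemma dotc_suml I (r : seq I) (P : pred I) (F : I -> 'cV[R]_d) y :
  dotc (\sum_(i <- r | P i) F i) y = \sum_(i <- r | P i) dotc (F i) y.
Proof.
by elim/big_rec2: _ => [|i a b _ <-]; rewrite ?dotc0l ?dotcDl.
Qed.

Lemma dotc_mulmx A x y : dotc x (A *m y) = dotc (A^T *m x) y.
Proof. by rewrite /dotc trmx_mul trmxK mulmxA. Qed.

Lemma dotc_ge0 x : 0 <= dotc x x.
Proof. by rewrite dotcE sumr_ge0// => i _; rewrite -expr2 sqr_ge0. Qed.

Lemma dotc_eq0 x : dotc x x = 0 -> x = 0.
Proof.
rewrite dotcE => /psumr_eq0P h; apply/colP => i; rewrite mxE; apply/eqP.
rewrite -[_ == _]sqrf_eq0 expr2 h// => j _.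
by rewrite -expr2 sqr_ge0.
Qed.

Lemma sqr_enorm x : enorm x ^+ 2 = dotc x x.
Proof. by rewrite sqr_sqrtr// dotc_ge0. Qed.

Lemma col_mulmx A N j : col j (A *m N) = A *m col j N.
Proof. by rewrite !colE mulmxA. Qed.

Lemma dotc_evec A i j : dotc (evec i) (A *m evec j) = A i j :> R.
Proof.
rewrite dotcE -colE (bigD1 i)//= big1 => [|k ki]; last first.
  by rewrite mxE (negbTE ki) mul0r.
by rewrite !mxE !eqxx mul1r addr0.
Qed.

(** Expand the nonnegative value of the form at [t x - y], then divide by [t]. *)
Lemma psd_young A x y t : A^T = A -> (forall z, 0 <= dotc z (A *m z)) ->
  0 < t -> 2 * dotc x (A *m y) <= t * dotc x (A *m x) + t^-1 * dotc y (A *m y).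
Proof.
move=> sA pA t0; have := pA (t *: x - y).
rewrite mulmxBr -scalemxAr !(dotcDl, dotcDr, dotcZl, dotcZr, dotcNl, dotcNr).
rewrite [dotc y (A *m x)]dotc_mulmx sA [dotc (A *m y) x]dotcC => h.
rewrite -(ler_pM2l t0) mulrDr !mulrA divff ?gt_eqF// mul1r -subr_ge0.
by apply: le_trans h _; lra.
Qed.

(** Young's inequality for the pair [A x], [x] loses its [t^-1] term, so [|A x|^2] is bounded by a
    multiple of every [t > 0]. *)
Lemma psd_ker A x : A^T = A -> (forall z, 0 <= dotc z (A *m z)) ->
  dotc x (A *m x) = 0 -> A *m x = 0.
Proof.
move=> sA pA x0; apply: dotc_eq0; apply/eqP; rewrite eq_le dotc_ge0 andbT.
apply: (@ler_small _ _ _ (2^-1 * dotc (A *m x) (A *m (A *m x)))) => t t0.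
have := psd_young (A *m x) x sA pA t0.
by rewrite x0; lra.
Qed.

(* The anticommuting commutator C = SN - NS is killed by the positive matrix
   S on both sides, so that C^T C = C (SN - NS) has trace 0. *)
Lemma psd_commute S N : S^T = S -> (forall z, 0 <= dotc z (S *m z)) ->
  N^T = - N -> S *m S *m N = N *m (S *m S) -> S *m N = N *m S.
Proof.
move=> sS pS aN SSN.
pose C := S *m N - N *m S.
have tC : C^T = C.
  by rewrite /C linearB/= !trmx_mul sS aN mulNmx mulmxN opprK addrC.
have SC : S *m C = - (C *m S).
  rewrite /C mulmxBr mulmxBl !mulmxA SSN !mulmxA.
  by rewrite opprB.
have trE (B : 'M[R]_d) : \tr (B^T *m (S *m B)) =
    \sum_j dotc (col j B) (S *m col j B).
  rewrite /mxtrace; apply: eq_bigr => j _.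
  rewrite -col_mulmx dotcE mxE; apply: eq_bigr => k _.
  by rewrite !mxE.
(* The trace is a sum of values of the form [S] at the columns of [C], hence nonnegative. The
   relation [S C = - C S] and cyclicity turn it into minus such a sum for [C^T]. Each term therefore
   vanishes, and [psd_ker] gives [S C = 0]. *)
have trSC : \tr (C^T *m (S *m C)) = 0.
  apply/eqP; rewrite eq_le; apply/andP; split; last first.
    by rewrite trE sumr_ge0.
  rewrite SC mulmxN linearN/= oppr_le0 mxtrace_mulC -mulmxA -{1}(trmxK C).
  by rewrite trE sumr_ge0.
have SC0 : S *m C = 0.
  apply/matrixP => i j; rewrite [RHS]mxE.
  move: trSC; rewrite trE => /psumr_eq0P/(_ j isT) h.
  have : S *m col j C = 0 by apply: psd_ker => //; apply: h => k _; exact: pS.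
  by rewrite -col_mulmx => /colP/(_ i); rewrite !mxE.
have CS0 : C *m S = 0 by rewrite -[C *m S]opprK -SC SC0 oppr0.
have trCC : \tr (C^T *m C) = 0.
  rewrite tC {2}/C mulmxBr !mulmxA CS0 mul0mx sub0r linearN/=.
  by rewrite mxtrace_mulC mulmxA SC0 mul0mx mxtrace0 oppr0.
apply/eqP; rewrite -subr_eq0 -/C; apply/eqP/matrixP => i j; rewrite [RHS]mxE.
have trI : \tr (C^T *m C) = \sum_j dotc (col j C) (col j C).
  rewrite /mxtrace; apply: eq_bigr => k _.
  by rewrite dotcE mxE; apply: eq_bigr => l _; rewrite !mxE.
move: trCC; rewrite trI => /psumr_eq0P/(_ j isT) h.
have : col j C = 0 by apply/dotc_eq0/h => k _; exact: dotc_ge0.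
by move=> /colP/(_ i); rewrite !mxE.
Qed.

(* With Se = S + e I, which is invertible and commutes with N, the vector
   z = Se^-1 N y satisfies (x, N y) = (x, Se z) and (z, Se z) <= (y, S y). *)
Lemma absmx_young N S x y t : N^T = - N -> is_sqrtmx (N *m N^T) S -> 0 < t ->
  2 * dotc x (N *m y) <= t * dotc x (S *m x) + t^-1 * dotc y (S *m y).
Proof.
move=> aN [sS pS SS] t0.
have SN : S *m N = N *m S.
  by apply: psd_commute => //; rewrite SS aN mulmxN mulNmx mulmxN mulmxA.
have NN : N^T *m N = S *m S by rewrite SS aN mulmxN mulNmx.
(* [S] may be singular; replacing it by [S + e I] costs [e * t * |x|^2], which disappears as [e]
   tends to 0. *)
apply: (@ler_small _ _ _ (t * dotc x x)) => e e0.
pose Se := S + e%:M.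
have Sev z : Se *m z = S *m z + e *: z by rewrite mulmxDl mul_scalar_mx.
have sSe : Se^T = Se by rewrite linearD/= tr_scalar_mx sS.
have pSe z : 0 <= dotc z (Se *m z).
  by rewrite Sev dotcDr dotcZr addr_ge0// mulr_ge0 ?dotc_ge0 ?ltW//.
have uSe : Se \in unitmx.
  rewrite unitmxE unitfE; apply/det0P => -[v v0 vS].
  move/eqP: v0; apply; apply: trmx_inj; rewrite trmx0; apply: dotc_eq0.
  have : Se *m v^T = 0 by rewrite -sSe -trmx_mul vS trmx0.
  rewrite Sev => /(congr1 (dotc v^T)); rewrite dotc0r dotcDr dotcZr => h.
  apply/eqP; rewrite eq_le dotc_ge0 andbT -(pmulr_rle0 _ e0).
  by rewrite -h lerDr pS.
pose w := invmx Se *m y; pose z := N *m w.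
have yE : y = Se *m w by rewrite mulmxA mulmxV// mul1mx.
have SeN : Se *m N = N *m Se.
  by rewrite mulmxDl mulmxDr SN mul_scalar_mx mul_mx_scalar.
have zE : N *m y = Se *m z by rewrite yE /z !mulmxA SeN.
have := psd_young x z sSe pSe t0; rewrite -zE => /le_trans; apply.
have -> : t * dotc x (Se *m x) = t * dotc x (S *m x) + e * (t * dotc x x).
  by rewrite Sev dotcDr dotcZr; ring.
rewrite addrAC lerD2r lerD2l ler_pM2l ?invr_gt0// zE.
have -> : dotc z (Se *m z) = dotc (S *m w) (S *m (S *m w)) +
    e * dotc (S *m w) (S *m w).
  rewrite /z (mulmxA Se) SeN -mulmxA dotc_mulmx mulmxA NN -mulmxA.
  rewrite Sev dotcDr dotcZr dotcC; congr (_ + e * _).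
  by rewrite dotcC (dotc_mulmx S w) sS.
have -> : dotc y (S *m y) = dotc (S *m w) (S *m (S *m w)) +
    2 * e * dotc (S *m w) (S *m w) + e ^+ 2 * dotc w (S *m w).
  rewrite yE Sev mulmxDr -scalemxAr !(dotcDl, dotcDr, dotcZl, dotcZr).
  by rewrite [dotc w (S *m (S *m w))]dotc_mulmx sS; ring.
rewrite -subr_ge0.
set a := dotc w (S *m w); set b := dotc (S *m w) (S *m w); set c := dotc _ _.
have -> : c + 2 * e * b + e ^+ 2 * a - (c + e * b) = e * b + e ^+ 2 * a by ring.
by rewrite addr_ge0// mulr_ge0 ?sqr_ge0 ?dotc_ge0 ?(ltW e0) ?pS.
Qed.

Lemma coord_le_enorm x i : `|x i ord0| <= enorm x.
Proof.
rewrite -(@ler_pXn2r _ 2)// ?nnegrE ?normr_ge0 ?sqrtr_ge0//.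
rewrite sqr_enorm dotcE real_normK ?num_real// (bigD1 i)//= -expr2 lerDl.
by rewrite sumr_ge0// => j _; rewrite -expr2 sqr_ge0.
Qed.

Lemma norm_dotc_le x y : `|dotc x y| <= enorm x * \sum_i `|y i ord0|.
Proof.
rewrite dotcE mulr_sumr (le_trans (ler_norm_sum _ _ _))// ler_sum// => i _.
by rewrite normrM; apply: ler_wpM2r => //; exact: coord_le_enorm.
Qed.

Lemma dotc_mx_le A x :
  dotc x (A *m x) <= (\sum_i \sum_j `|A i j|) * enorm x ^+ 2.
Proof.
rewrite dotcE mulr_suml ler_sum// => i _.
rewrite mxE mulr_sumr mulr_suml ler_sum// => j _.
rewrite (le_trans (ler_norm _))// !normrM mulrCA ler_wpM2l//.
by rewrite expr2 ler_pM// coord_le_enorm.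
Qed.

(** * Kernels, their orthogonal complements, and ellipticity on the complement *)

Lemma kerc_cokermx A j : kerc A (col j (cokermx A)).
Proof. by rewrite /kerc/= -col_mulmx mulmx_coker; apply/colP => i; rewrite !mxE. Qed.

Lemma orthc_kerc_sub A x :
  (forall j, dotc x (col j (cokermx A)) = 0) -> (x^T <= A)%MS.
Proof.
move=> h; rewrite submxE; apply/eqP/rowP => j; rewrite [RHS]mxE -[RHS](h j).
by rewrite /dotc !mxE; apply: eq_bigr => k _; rewrite !mxE.
Qed.

(** Orthogonality to the columns of the cokernel puts [x^T] in the row space of [A], which is
    orthogonal to the whole kernel. Only finitely many vectors are tested, so almost sure
    orthogonality can be checked one vector at a time. *)
Lemma orthc_kercP A x :
  orthc (kerc A) x <-> forall j, dotc x (col j (cokermx A)) = 0.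
Proof.
split=> [h j|/orthc_kerc_sub/submxP[w xE] k Ak]; first exact/h/kerc_cokermx.
by rewrite /dotc xE -mulmxA Ak mulmx0 mxE.
Qed.

(** On the complement of the kernel [x = A (P^T x)], with [P] the pseudo-inverse. Young's inequality
    with [t = c + 1], where [c] bounds the form of [P], gives
    [2 |x|^2 <= (c + 1) (x, A x) + |x|^2]. *)
Lemma psd_orthc_ker_ge A : A^T = A -> (forall z, 0 <= dotc z (A *m z)) ->
  exists2 c, 0 < c & forall x, orthc (kerc A) x ->
    enorm x ^+ 2 <= c * dotc x (A *m x).
Proof.
move=> sA pA; pose P := pinvmx A.
pose c := \sum_i \sum_j `|P i j|.
have c0 : 0 <= c by rewrite sumr_ge0// => i _; rewrite sumr_ge0.
have c1 : 0 < c + 1 by rewrite ltr_wpDl.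
exists (c + 1) => // x /orthc_kercP/orthc_kerc_sub/mulmxKpV xE.
have {}xE : x = A *m (P^T *m x).
  by apply: trmx_inj; rewrite (trmx_mul A) (trmx_mul P^T) trmxK sA xE.
have := psd_young x (P^T *m x) sA pA c1; rewrite -xE -sqr_enorm.
have -> : dotc (P^T *m x) x = dotc x (P *m x) by rewrite [RHS]dotc_mulmx.
move=> h; have := dotc_mx_le P x; rewrite -/c => hP.
have : (c + 1)^-1 * dotc x (P *m x) <= enorm x ^+ 2.
  rewrite mulrC ler_pdivrMr// (le_trans hP)// mulrC ler_wpM2l ?sqr_ge0//.
  by rewrite lerDl.
by lra.
Qed.

End euclidean.

(** * The space L^2 *)

Lemma Rintegral_sum d (T : measurableType d) (R : realType)
    (m : {measure set T -> \bar R}) (D : set T) I (s : seq I) (F : I -> T -> R) :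
  measurable D -> (forall i, m.-integrable D (EFin \o F i)) ->
  \int[m]_(w in D) (\sum_(i <- s) F i w) = \sum_(i <- s) \int[m]_(w in D) F i w.
Proof.
move=> mD Fi; elim: s => [|i s IH].
  rewrite big_nil; under eq_Rintegral do rewrite big_nil.
  by rewrite Rintegral_cst// mul0r.
rewrite big_cons -IH -RintegralD//.
  by apply: eq_Rintegral => w _; rewrite big_cons.
rewrite (_ : EFin \o _ = fun w => (\sum_(j <- s) (EFin \o F j) w)%E).
  exact: integrable_sum.
by apply/funext => w; rewrite /= sumEFin.
Qed.

Section square_integrable.
Context {R : realType} {dO : measure_display} {Om : measurableType dO}.
Variable mu : probability Om R.
Implicit Types (f g h : Om -> R).

Local Notation itg f := (mu.-integrable [set: Om] (EFin \o f)).

Lemma itgD f g : itg f -> itg g -> itg (fun w => f w + g w).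
Proof. by move=> fi gi; exact: (integrableD measurableT fi gi). Qed.

Lemma itgZ (c : R) f : itg f -> itg (fun w => c * f w).
Proof. by move=> fi; exact: (integrableZl measurableT c fi). Qed.

Lemma itg0 : itg (fun=> 0).
Proof. exact: integrable0. Qed.

Lemma itg_sum I (s : seq I) (F : I -> Om -> R) :
  (forall i, itg (F i)) -> itg (fun w => \sum_(i <- s) F i w).
Proof.
move=> Fi; elim: s => [|i s IH].
  by under eq_fun do rewrite big_nil; exact: itg0.
by under eq_fun do rewrite big_cons; exact: itgD.
Qed.

Lemma L2_measurable f : L2 mu f -> measurable_fun [set: Om] f.
Proof. by rewrite /L2/= inE => /andP[/[!inE]]. Qed.

Lemma L2_sqr f : L2 mu f -> itg (fun w => f w ^+ 2).
Proof. exact: Lfun2_integrable_sqr. Qed.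

Lemma itg_L2 f : measurable_fun [set: Om] f -> itg (fun w => f w ^+ 2) -> L2 mu f.
Proof.
move=> mf /integrableP[_ foo]; rewrite /L2/= inE; apply/andP; split; rewrite inE//=.
rewrite /finite_norm unlock /Lnorm poweR_lty//.
apply: le_lt_trans foo; rewrite le_eqVlt; apply/orP; left; apply/eqP.
by apply: eq_integral => w _ /=; rewrite powR_mulrn// normrX.
Qed.

Lemma L2_mul f g : L2 mu f -> L2 mu g -> itg (fun w => f w * g w).
Proof. by move=> Lf Lg; apply/Lfun1_integrable; exact: Lfun2_mul_Lfun1. Qed.

Let le12 : (1 <= 2%:E :> \bar R)%E.
Proof. by rewrite lee_fin ler1n. Qed.

Lemma L2D f g : L2 mu f -> L2 mu g -> L2 mu (fun w => f w + g w).
Proof. by case: (Lfun_addr_closed mu le12) => _; exact. Qed.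

Lemma L2_cst (c : R) : L2 mu (fun=> c).
Proof. exact: Lfun_cst. Qed.

Lemma L2_bounded f g (C : R) : measurable_fun [set: Om] g ->
  (forall w, `|g w| <= C) -> L2 mu f -> L2 mu (fun w => g w * f w).
Proof.
move=> mg gC Lf; have mf := L2_measurable Lf.
have mgf : measurable_fun [set: Om] (fun w => g w * f w).
  exact: measurable_funM.
apply: itg_L2 => //.
apply: (le_integrable measurableT _ _ (itgZ (C ^+ 2) (L2_sqr Lf))) => [|w _].
  by apply/measurable_EFinP; exact: measurable_funX.
rewrite /= lee_fin exprMn [leLHS]normrM [leRHS]normrM; apply: ler_wpM2r => //.
rewrite !normrX lerXn2r// ?nnegrE//.
exact: le_trans (gC w) (ler_norm C).
Qed.

Lemma L2Z (c : R) f : L2 mu f -> L2 mu (fun w => c * f w).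
Proof. exact: (@L2_bounded f (fun=> c) `|c|). Qed.

Lemma L2B f g : L2 mu f -> L2 mu g -> L2 mu (fun w => f w - g w).
Proof.
move=> Lf Lg; have := L2D Lf (L2Z (-1) Lg).
by congr (L2 mu _); apply/funext => w; rewrite mulN1r.
Qed.

Lemma L2_sum I (s : seq I) (F : I -> Om -> R) :
  (forall i, L2 mu (F i)) -> L2 mu (fun w => \sum_(i <- s) F i w).
Proof.
move=> LF; elim: s => [|i s IH].
  by under eq_fun do rewrite big_nil; exact: L2_cst.
by under eq_fun do rewrite big_cons; exact: L2D.
Qed.

Lemma dot2C f g : dot2 mu f g = dot2 mu g f.
Proof. by apply: eq_Rintegral => w _; rewrite mulrC. Qed.

Lemma dot2Dl f g h : L2 mu f -> L2 mu g -> L2 mu h ->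
  dot2 mu (fun w => f w + g w) h = dot2 mu f h + dot2 mu g h.
Proof.
move=> Lf Lg Lh; rewrite /dot2 -RintegralD ?L2_mul//.
by apply: eq_Rintegral => w _; rewrite mulrDl.
Qed.

Lemma dot2Zl (c : R) f g : L2 mu f -> L2 mu g ->
  dot2 mu (fun w => c * f w) g = c * dot2 mu f g.
Proof.
move=> Lf Lg; rewrite /dot2 -RintegralZl ?L2_mul//.
by apply: eq_Rintegral => w _; rewrite mulrA.
Qed.

Lemma dot2Bl f g h : L2 mu f -> L2 mu g -> L2 mu h ->
  dot2 mu (fun w => f w - g w) h = dot2 mu f h - dot2 mu g h.
Proof.
move=> Lf Lg Lh; rewrite /dot2 -RintegralB ?L2_mul//.
by apply: eq_Rintegral => w _; rewrite mulrBl.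
Qed.

Lemma dot2_suml I (s : seq I) (F : I -> Om -> R) g :
  (forall i, L2 mu (F i)) -> L2 mu g ->
  dot2 mu (fun w => \sum_(i <- s) F i w) g = \sum_(i <- s) dot2 mu (F i) g.
Proof.
move=> LF Lg; rewrite /dot2 -Rintegral_sum// => [|i]; last exact: L2_mul.
by apply: eq_Rintegral => w _; rewrite mulr_suml.
Qed.

Lemma dot2_ge0 f : 0 <= dot2 mu f f.
Proof. by apply: Rintegral_ge0 => w _; rewrite -expr2 sqr_ge0. Qed.

Lemma sqr_norm2 f : norm2 mu f ^+ 2 = dot2 mu f f.
Proof. by rewrite sqr_sqrtr// dot2_ge0. Qed.

Lemma cauchy_schwarz2 f g : L2 mu f -> L2 mu g ->
  `|dot2 mu f g| <= norm2 mu f * norm2 mu g.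
Proof.
move=> Lf Lg.
have quad (s : R) :
    0 <= dot2 mu f f + 2 * s * dot2 mu f g + s ^+ 2 * dot2 mu g g.
  have Lsg := L2Z s Lg; have Lfg := L2D Lf Lsg.
  have := dot2_ge0 (fun w => f w + s * g w).
  rewrite dot2Dl// (dot2C f) (dot2C (fun w => s * g w)) !dot2Dl// !dot2Zl//.
  rewrite (dot2C f (fun w => s * g w)) dot2Zl// (dot2C g (fun w => s * g w)).
  rewrite dot2Zl// (dot2C g f) => h; apply: le_trans h _.
  by rewrite le_eqVlt; apply/orP; left; apply/eqP; ring.
rewrite -(@ler_pXn2r _ 2)// ?nnegrE ?normr_ge0 ?mulr_ge0 ?sqrtr_ge0//.
rewrite exprMn !sqr_norm2 real_normK ?num_real//.
(* If [|g|_2 > 0], the quadratic in [s] is evaluated at its minimum. Otherwise it is affine in [s],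
   and [s = - (f, g)_2 / (2 t)] with [t -> 0] forces [(f, g)_2 = 0]. *)
have := dot2_ge0 g; rewrite le_eqVlt => /predU1P[g0|g0]; last first.
  have := quad (- dot2 mu f g / dot2 mu g g).
  rewrite -(pmulr_rge0 _ g0) => h; rewrite -subr_ge0; apply: le_trans h _.
  rewrite le_eqVlt; apply/orP; left; apply/eqP; field.
  by rewrite gt_eqF.
rewrite -g0 mulr0; apply: (@ler_small _ _ _ (dot2 mu f f)) => t t0.
have := quad (- dot2 mu f g / (2 * t)); rewrite -g0 mulr0 addr0.
rewrite -(pmulr_rge0 _ t0) add0r => h; rewrite -subr_ge0; apply: le_trans h _.
rewrite le_eqVlt; apply/orP; left; apply/eqP; field.
by rewrite gt_eqF.
Qed.

(** Strong convergence implies weak convergence, by Cauchy-Schwarz. The filter is arbitrary because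
    both difference quotients and sequences are treated. *)
Lemma norm2_cvg_dot2 T (F : set_system T) {FF : Filter F} (u : T -> Om -> R) f g :
  (forall t, L2 mu (u t)) -> L2 mu f -> L2 mu g ->
  norm2 mu (fun w => u t w - f w) @[t --> F] --> (0 : R) ->
  dot2 mu (u t) g @[t --> F] --> dot2 mu f g.
Proof.
move=> Lu Lf Lg uf; apply/subr_cvg0.
have uf0 : norm2 mu (fun w => u t w - f w) * norm2 mu g @[t --> F] --> (0 : R).
  by rewrite -(mul0r (norm2 mu g)); exact: cvgMr_tmp uf.
apply: (@squeeze_cvgr _ _ _ _ _ _ _ _ _ _ uf0); last first.
  by rewrite -oppr0; exact: cvgN uf0.
by apply: nearW => t; rewrite -ler_norml -dot2Bl// cauchy_schwarz2//; exact: L2B.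
Qed.

End square_integrable.

(** * Translations *)

Section translations.
Context {R : realType} {d : nat} {dO : measure_display} {Om : measurableType dO}.
Variables (mu : probability Om R) (tau : 'cV[R]_d -> Om -> Om).
Hypothesis medium : random_medium mu tau.
Implicit Types (f g k : Om -> R) (x : 'cV[R]_d).

Local Notation itg f := (mu.-integrable [set: Om] (EFin \o f)).

Let mtau x : measurable_fun [set: Om] (tau x).
Proof. by case: medium => _ /(_ x)[]. Qed.

Let pushE x A : measurable A -> A `<=` [set: Om] -> pushforward mu (tau x) A = mu A.
Proof. by move=> mA _; case: medium => _ /(_ x)[_ h] _ _; exact: h. Qed.

Lemma itg_tau k x : itg k -> itg (fun w => k (tau x w)).
Proof.
move=> /integrableP[mk koo]; have mkt : measurable_fun [set: Om] (fun w => (k (tau x w))%:E).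
  exact: (measurableT_comp mk (mtau x)).
apply/integrableP; split => //.
apply: le_lt_trans koo; rewrite le_eqVlt; apply/orP; left; apply/eqP.
rewrite -[RHS](eq_measure_integral mu (@pushE x)).
rewrite (ge0_integral_pushforward (mtau x))//.
exact: measurableT_comp.
Qed.

Lemma Rintegral_tau k x : itg k -> \int[mu]_w k (tau x w) = \int[mu]_w k w.
Proof.
move=> ik; congr fine.
rewrite -[RHS](eq_measure_integral mu (@pushE x)).
rewrite (integral_pushforward (mtau x))//; last exact: itg_tau.
by case/integrableP: ik.
Qed.

Lemma L2_tau f x : L2 mu f -> L2 mu (fun w => f (tau x w)).
Proof.
move=> Lf; apply: itg_L2; last exact: (itg_tau x (L2_sqr Lf)).
exact: measurableT_comp (L2_measurable Lf) (mtau x).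
Qed.

(** By invariance of [mu], the integral of [f(w) g(tau (- x) w)] is unchanged when [w] is replaced
    by [tau x w]. *)
Lemma dot2_tau f g x : L2 mu f -> L2 mu g ->
  dot2 mu (fun w => f (tau x w)) g = dot2 mu f (fun w => g (tau (- x) w)).
Proof.
move=> Lf Lg; rewrite /dot2 -[RHS](Rintegral_tau x); last first.
  by apply: L2_mul => //; exact: L2_tau.
apply: eq_Rintegral => w _; congr (_ * g _).
by case: medium => -[t0 tD] _ _ _; rewrite -tD addNr t0.
Qed.

(** The adjoint of translation by [h e_i] is translation by [- h e_i], so the difference quotient at
    [h] has minus the one at [- h] as its adjoint; both sides pass to the limit. *)
Lemma is_D_antisym i f f' g g' : is_D mu tau i f f' -> is_D mu tau i g g' ->
  dot2 mu f' g = - dot2 mu f g'.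
Proof.
move=> [Lf Lf' Df] [Lg Lg' Dg].
pose q k (h : R) w := h^-1 * (k (tau (h *: evec i) w) - k w).
have Lq k h : L2 mu k -> L2 mu (q k h).
  by move=> Lk; apply/L2Z/L2B => //; exact: L2_tau.
have qE h : dot2 mu (q f h) g = - dot2 mu (q g (- h)) f.
  rewrite /q !dot2Zl ?dot2Bl//; try exact: L2_tau; try (apply: L2B => //; exact: L2_tau).
  rewrite invrN mulNr opprK dot2_tau// scaleNr; congr (_ * (_ - _)).
    exact: dot2C.
  exact: dot2C.
have lim1 : dot2 mu (q f h) g @[h --> (0 : R)^'] --> dot2 mu f' g.
  by apply: norm2_cvg_dot2 => // h; exact: Lq.
have lim2 : dot2 mu (q f h) g @[h --> (0 : R)^'] --> - dot2 mu f g'.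
  rewrite (dot2C mu f); under eq_fun do rewrite qE.
  apply: cvgN.
  have : dot2 mu (q g h) f @[h --> (0 : R)^'] --> dot2 mu g' f.
    by apply: norm2_cvg_dot2 => // h; exact: Lq.
  (* Punctured neighbourhoods of 0 are stable under [h -> - h]. *)
  apply: cvg_comp => B; rewrite -{1}oppr0 dnbhsN => -[A A0 <-].
  by apply: filterS A0 => h Ah; exists h.
exact: (cvg_unique _ lim1 lim2).
Qed.

End translations.

(** * Vector fields *)

Section vector_fields.
Context {R : realType} {d : nat} {dO : measure_display} {Om : measurableType dO}.
Variable mu : probability Om R.
Implicit Types (F G : Om -> 'cV[R]_d) (A : Om -> 'M[R]_d).

Local Notation itg f := (mu.-integrable [set: Om] (EFin \o f)).

Definition L2v F := forall i, L2 mu (fun w => F w i ord0).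

Definition bounded_mx A :=
  (forall i j, measurable_fun [set: Om] (fun w => A w i j)) /\
  exists C, forall w i j, `|A w i j| <= C.

Definition dotv F G : R := \int[mu]_w dotc (F w) (G w).

Lemma L2v_cst (x : 'cV[R]_d) : L2v (fun=> x).
Proof. by move=> i; exact: L2_cst. Qed.

Lemma L2vD F G : L2v F -> L2v G -> L2v (fun w => F w + G w).
Proof. by move=> LF LG i; under eq_fun do rewrite mxE; exact: L2D. Qed.

Lemma L2vZ (c : R) F : L2v F -> L2v (fun w => c *: F w).
Proof. by move=> LF i; under eq_fun do rewrite mxE; exact: L2Z. Qed.

Lemma L2v_sum I (s : seq I) (F : I -> Om -> 'cV[R]_d) :
  (forall i, L2v (F i)) -> L2v (fun w => \sum_(i <- s) F i w).
Proof. by move=> LF i; under eq_fun do rewrite summxE; apply: L2_sum => j; exact: LF. Qed.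

Lemma L2v_mulmx A F : bounded_mx A -> L2v F -> L2v (fun w => A w *m F w).
Proof.
move=> [mA [C AC]] LF i; under eq_fun do rewrite mxE.
by apply: L2_sum => j; apply: (@L2_bounded _ _ _ _ _ _ C).
Qed.

Lemma bounded_mxD A B : bounded_mx A -> bounded_mx B ->
  bounded_mx (fun w => A w + B w).
Proof.
move=> [mA [C AC]] [mB [C' BC]]; split=> [i j|].
  by under eq_fun do rewrite mxE; exact: measurable_funD.
by exists (C + C') => w i j; rewrite mxE (le_trans (ler_normD _ _))// lerD.
Qed.

Lemma bounded_mx_mul_tr A : bounded_mx A -> bounded_mx (fun w => A w *m (A w)^T).
Proof.
move=> [mA [C AC]]; split=> [i j|].
  under eq_fun do rewrite mxE.
  apply: measurable_sum => k; under eq_fun do rewrite mxE.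
  exact: measurable_funM.
exists (\sum_(k < d) C * C) => w i j; rewrite mxE (le_trans (ler_norm_sum _ _ _))//.
by apply: ler_sum => k _; rewrite mxE normrM ler_pM.
Qed.

Lemma itg_dotc F G : L2v F -> L2v G -> itg (fun w => dotc (F w) (G w)).
Proof.
by move=> LF LG; under eq_fun do rewrite dotcE; apply: itg_sum => i; exact: L2_mul.
Qed.

Lemma dotvE F G : L2v F -> L2v G ->
  dotv F G = \sum_i dot2 mu (fun w => F w i ord0) (fun w => G w i ord0).
Proof.
move=> LF LG; rewrite /dotv /dot2 -Rintegral_sum// => [|i]; last exact: L2_mul.
by apply: eq_Rintegral => w _; rewrite dotcE.
Qed.

Lemma dotvC F G : dotv F G = dotv G F.
Proof. by apply: eq_Rintegral => w _; rewrite dotcC. Qed.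

Lemma dotvDl F F' G : L2v F -> L2v F' -> L2v G ->
  dotv (fun w => F w + F' w) G = dotv F G + dotv F' G.
Proof.
move=> LF LF' LG; rewrite /dotv -RintegralD//; try exact: itg_dotc.
by apply: eq_Rintegral => w _; rewrite dotcDl.
Qed.

Lemma dotvDr F F' G : L2v F -> L2v F' -> L2v G ->
  dotv G (fun w => F w + F' w) = dotv G F + dotv G F'.
Proof. by move=> *; rewrite dotvC dotvDl// !(dotvC G). Qed.

Lemma dotvZl (c : R) F G : L2v F -> L2v G ->
  dotv (fun w => c *: F w) G = c * dotv F G.
Proof.
move=> LF LG; rewrite /dotv -RintegralZl//; last exact: itg_dotc.
by apply: eq_Rintegral => w _; rewrite dotcZl.
Qed.

Lemma dotv_suml I (s : seq I) (F : I -> Om -> 'cV[R]_d) G :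
  (forall i, L2v (F i)) -> L2v G ->
  dotv (fun w => \sum_(i <- s) F i w) G = \sum_(i <- s) dotv (F i) G.
Proof.
move=> LF LG; rewrite /dotv -Rintegral_sum// => [|i]; last exact: itg_dotc.
by apply: eq_Rintegral => w _; rewrite dotc_suml.
Qed.

Lemma dotv_linl (x : 'cV[R]_d) (F : 'I_d -> Om -> 'cV[R]_d) G :
  (forall i, L2v (F i)) -> L2v G ->
  dotv (fun w => \sum_i x i ord0 *: F i w) G = \sum_i x i ord0 * dotv (F i) G.
Proof.
move=> LF LG; rewrite dotv_suml// => [|i]; last exact: L2vZ.
by apply: eq_bigr => i _; rewrite dotvZl.
Qed.

Lemma le_dotv F G F' G' : L2v F -> L2v G -> L2v F' -> L2v G' ->
  (forall w, dotc (F w) (G w) <= dotc (F' w) (G' w)) -> dotv F G <= dotv F' G'.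
Proof. by move=> *; apply: le_Rintegral => //; exact: itg_dotc. Qed.

(** Integrates pointwise inequalities of Young type; this is how matrix bounds become bounds on
    forms of vector fields. *)
Lemma le_dotv2 (a b c : R) F G F1 G1 F2 G2 :
  L2v F -> L2v G -> L2v F1 -> L2v G1 -> L2v F2 -> L2v G2 ->
  (forall w, a * dotc (F w) (G w) <=
     b * dotc (F1 w) (G1 w) + c * dotc (F2 w) (G2 w)) ->
  a * dotv F G <= b * dotv F1 G1 + c * dotv F2 G2.
Proof.
move=> LF LG LF1 LG1 LF2 LG2 h.
have i0 := itg_dotc LF LG; have i1 := itg_dotc LF1 LG1; have i2 := itg_dotc LF2 LG2.
rewrite /dotv -!RintegralZl// -RintegralD//; try exact: itgZ.
by apply: le_Rintegral => // ; [exact: itgZ|apply: itgD; exact: itgZ].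
Qed.

End vector_fields.

(** * Correctors and homogenized coefficients *)

Section homogenization.
Context {R : realType} {d : nat} {dO : measure_display} {Om : measurableType dO}.
Variables (mu : probability Om R) (tau : 'cV[R]_d -> Om -> Om).
Variables (sigma H : Om -> 'cV[R]_d -> 'M[R]_d) (sigmat : Om -> 'M[R]_d).
Variables (V : 'cV[R]_d -> R) (Lam M : R) (u : R -> 'I_d -> 'cV[R]_d -> Om -> R).
Hypotheses (d_gt0 : (0 < d)%N) (M_gt0 : 0 < M).
Hypothesis medium : random_medium mu tau.
Hypothesis measurable_coeffs : measurable_coefficients sigma H sigmat V.
Hypothesis H_antisym : forall w y, (H w y)^T = - H w y.
Hypothesis reg : regularity tau sigma H sigmat Lam V.
Hypothesis ctrl : control sigma H sigmat M V.
Hypothesis u_corrector : forall lam i y, 0 < lam ->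
  corrector mu tau sigma H sigmat lam i y (u lam i y).

Local Notation a := (amx sigma).
Local Notation at_ := (atmx sigmat).
Local Notation appr := (Defs.approx mu tau sigmat).
Local Notation L2v := (L2v mu).
Local Notation dotv := (dotv mu).

(** * Boundedness of the coefficients and pointwise inequalities between them *)

Lemma mx_norm_le (A : 'M[R]_d) i j : `|A i j| <= `|A|.
Proof.
rewrite [leRHS]/Num.norm/= mx_normrE.
exact: (le_bigmax _ (fun p : 'I_d * 'I_d => `|A p.1 p.2|) (i, j)).
Qed.

Lemma measurable_entry (F : Om -> 'M[R]_d) i j :
  measurable_fun [set: Om] F -> measurable_fun [set: Om] (fun w => F w i j).
Proof.
move=> mF _ B mB; rewrite setTI.
have := mF measurableT ((fun N : 'M[R]_d => N i j) @^-1` B).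
rewrite setTI; apply; apply: sub_sigma_algebra.
by exists i, j, B.
Qed.

(** The regularity bounds concern the fields along orbits of [tau]; evaluating them at [x = 0],
    where [tau 0] is the identity, bounds the functions on [Om]. *)
Lemma bounded_sigma y : bounded_mx (sigma ^~ y).
Proof.
have [t0 _] : (forall w, tau 0 w = w) /\ True by case: medium => -[].
split=> [i j|].
  case: measurable_coeffs => ms _ _ _; apply: measurable_entry.
  exact: (measurable_fun_pair1 y ms).
exists Lam => w i j; rewrite (le_trans (mx_norm_le _ _ _))//.
case: reg => /(_ w)[[_ _ _ /(_ [::] isT)[h _]] _ _] _.
by have := h 0 y; rewrite t0.
Qed.

Lemma bounded_H y : bounded_mx (H ^~ y).
Proof.
have [t0 _] : (forall w, tau 0 w = w) /\ True by case: medium => -[].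
split=> [i j|].
  case: measurable_coeffs => _ ms _ _; apply: measurable_entry.
  exact: (measurable_fun_pair1 y ms).
exists Lam => w i j; rewrite (le_trans (mx_norm_le _ _ _))//.
case: reg => /(_ w)[_ [_ _ _ /(_ [::] isT)[h _]] _] _.
by have := h 0 y; rewrite t0.
Qed.

Lemma bounded_at : bounded_mx at_.
Proof.
apply: bounded_mx_mul_tr.
have [t0 _] : (forall w, tau 0 w = w) /\ True by case: medium => -[].
split=> [i j|].
  by case: measurable_coeffs => _ _ ms _; exact: measurable_entry.
exists Lam => w i j; rewrite (le_trans (mx_norm_le _ _ _))//.
case: reg => /(_ w)[_ _ [_ /(_ [::] isT)[h _]]] _.
by have := h 0; rewrite /= t0.
Qed.

Lemma bounded_a y : bounded_mx (a ^~ y).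
Proof. exact: (bounded_mx_mul_tr (bounded_sigma y)). Qed.

Lemma mul_tr_psd (A : 'M[R]_d) z : 0 <= dotc z ((A *m A^T) *m z).
Proof. by rewrite -mulmxA dotc_mulmx dotc_ge0. Qed.

Lemma mul_tr_sym (A : 'M[R]_d) : (A *m A^T)^T = A *m A^T.
Proof. by rewrite trmx_mul trmxK. Qed.

Lemma at_le_a w y z : dotc z (at_ w *m z) <= M * dotc z (a w y *m z).
Proof.
case: ctrl => /(_ w y)[/(_ z) h _] _ _ _ _; move: h.
by rewrite -scalemxAl dotcZr mulrC ler_pdivrMr// mulrC.
Qed.

Lemma a_le_at w y z : dotc z (a w y *m z) <= M * dotc z (at_ w *m z).
Proof.
by case: ctrl => /(_ w y)[_ /(_ z)] + _ _ _ _; rewrite -scalemxAl dotcZr.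
Qed.

(** The control of [H] at the empty list of derivatives provides [S = |H|] with [S <= M a~], to
    which [absmx_young] applies. *)
Lemma H_young w y x z t : 0 < t ->
  2 * dotc x (H w y *m z) <=
    (t * M) * dotc x (at_ w *m x) + (t^-1 * M) * dotc z (at_ w *m z).
Proof.
move=> t0; case: ctrl => _ _ /(_ w [::] isT)[/(_ y) [S HS SM] _] _ _.
apply: le_trans (absmx_young x z (H_antisym w y) HS t0) _.
have {}SM v : dotc v (S *m v) <= M * dotc v (at_ w *m v).
  by have := SM v; rewrite -scalemxAl dotcZr.
by rewrite -!mulrA lerD// ler_pM2l ?invr_gt0.
Qed.

Lemma aH_young w y x z t : 0 < t ->
  2 * dotc x ((a w y + H w y) *m z) <=
    (2 * t * M) * dotc x (at_ w *m x) + (2 * t^-1 * M) * dotc z (at_ w *m z).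
Proof.
move=> t0; rewrite mulmxDl dotcDr.
have := H_young w y x z t0.
have := psd_young x z (mul_tr_sym (sigma w y)) (mul_tr_psd (sigma w y)) t0.
rewrite -/(amx sigma w y).
have := ler_wpM2l (ltW t0) (a_le_at w y x).
have ti0 : 0 <= t^-1 by rewrite invr_ge0 ltW.
have := ler_wpM2l ti0 (a_le_at w y z).
rewrite !mulrA.
by lra.
Qed.

Lemma H_dotc0 w y z : dotc z (H w y *m z) = 0.
Proof.
have : dotc z (H w y *m z) = - dotc z (H w y *m z).
  by rewrite {1}dotc_mulmx H_antisym mulNmx dotcNl dotcC.
by lra.
Qed.

(** * Approximating sequences and the weak corrector equation *)

Lemma grad_L2v f F : is_grad mu tau f F -> L2v F.
Proof. by move=> gF i; case: (gF i). Qed.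

(** The condition [is_grad] speaks about [f] only through its partial derivatives, so a coordinate
    is needed; it exists because [d > 0]. *)
Lemma grad_L2 f F : is_grad mu tau f F -> L2 mu f.
Proof. by move=> /(_ (Ordinal d_gt0))[]. Qed.

Lemma appr_L2v phi f F n : appr phi f F -> L2v (F n).
Proof. by case=> /(_ n)[_ /grad_L2v]. Qed.

(** Constant sequences make elements of [core] admissible as test functions in [H1], with their own
    gradient as approximation. *)
Lemma appr_cst f F : core mu tau f -> is_grad mu tau f F ->
  appr f (fun=> f) (fun=> F).
Proof.
move=> cf gF; split=> [//||e e0].
  rewrite (_ : (fun=> _) = fun=> 0); first exact: cvg_cst.
  apply/funext => n; rewrite /norm2 /dot2.
  under eq_Rintegral do rewrite /= subrr mul0r.
  by rewrite Rintegral_cst// mul0r sqrtr0.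
exists 0%N => m n _ _; rewrite /form1.
under eq_Rintegral do rewrite /= subrr dotc0r.
by rewrite Rintegral_cst// mul0r mulr0.
Qed.

Lemma appr_dot2 phi f F g : L2 mu phi -> L2 mu g -> appr phi f F ->
  dot2 mu g (f n) @[n --> \oo] --> dot2 mu g phi.
Proof.
move=> Lphi Lg [cf fphi _]; rewrite dot2C; under eq_fun do rewrite dot2C.
by apply: norm2_cvg_dot2 => // n; case: (cf n) => _ /grad_L2.
Qed.

Lemma corrector_H1 lam i y : 0 < lam -> H1 mu tau sigmat (u lam i y).
Proof. by move=> l0; case: (u_corrector i y l0) => g [b [[]]]. Qed.

Lemma corrector_appr lam y : 0 < lam ->
  exists (f : 'I_d -> nat -> Om -> R) (F : 'I_d -> nat -> Om -> 'cV[R]_d),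
    forall i, appr (u lam i y) (f i) (F i).
Proof.
move=> l0.
have /choice[p hp] : forall i, exists p, appr (u lam i y) p.1 p.2.
  by move=> i; case: (corrector_H1 i y l0) => _ [f [F h]]; exists (f, F).
by exists (fun i => (p i).1), (fun i => (p i).2).
Qed.

(* The antisymmetry of the D_k turns the divergence b_i into
   1/2 ((a + H) e_i, D phi)_2, which merges with the form of L^y. *)
Lemma corrector_weak lam i y f F phi g G : 0 < lam -> H1 mu tau sigmat phi ->
  appr (u lam i y) f F -> appr phi g G ->
  2^-1 * dotv (G n) (fun w => (a w y + H w y) *m (evec i + F n w))
    @[n --> \oo] --> - (lam * dot2 mu (u lam i y) phi).
Proof.
move=> l0 H1phi uF phiG.
have [Lu _] := corrector_H1 i y l0; have [Lphi _] := H1phi.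
have [g0 [b [[_ Lg0 Lu_weak] [gb [Dgb bE]] eqn]]] := u_corrector i y l0.
have Lb : L2 mu b.
  rewrite bE; apply/L2Z/L2_sum => k.
  by case: (Dgb k).
have bdd : bounded_mx (fun w => a w y + H w y).
  by apply: bounded_mxD; [exact: bounded_a|exact: bounded_H].
have LG n := appr_L2v n phiG; have LF n := appr_L2v n uF.
(* The corrector equation [lam u = g0 + b] holds only almost everywhere, hence the comparison of
   integrals. The two resulting terms are the limits of the form and of the divergence term. *)
have -> : - (lam * dot2 mu (u lam i y) phi) = - dot2 mu g0 phi - dot2 mu b phi.
  rewrite -opprD -dot2Dl// -dot2Zl//; congr (- fine _).
  have Lsum := L2D Lg0 Lb; have Llu := L2Z lam Lu.
  apply: ae_eq_integral => //.
  - apply/measurable_EFinP; apply: measurable_funM; last exact: L2_measurable Lphi.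
    exact: L2_measurable Llu.
  - apply/measurable_EFinP; apply: measurable_funM; last exact: L2_measurable Lphi.
    exact: L2_measurable Lsum.
  - by apply: filterS eqn => w /= <- _; rewrite addrC subrK.
have e1 n : 2^-1 * dotv (G n) (fun w => (a w y + H w y) *m (evec i + F n w)) =
    formBL mu sigma H y (F n) (G n) - dot2 mu b (g n).
  have LAe : L2v (fun w => (a w y + H w y) *m evec i).
    by apply: L2v_mulmx => //; exact: L2v_cst.
  have LAF : L2v (fun w => (a w y + H w y) *m F n w) by exact: L2v_mulmx.
  have -> : (fun w => (a w y + H w y) *m (evec i + F n w)) =
      (fun w => (a w y + H w y) *m evec i + (a w y + H w y) *m F n w).
    by apply/funext => w; rewrite mulmxDr.
  rewrite dotvDr// mulrDr addrC; congr (_ + _); first by rewrite dotvC.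
  rewrite dotvE// bE; case: phiG => /(_ n)[_ gG] _ _.
  have Lgn := grad_L2 gG.
  rewrite dot2Zl//; last by apply: L2_sum => k; case: (Dgb k).
  rewrite dot2_suml//; last by move=> k; case: (Dgb k).
  rewrite -mulrN -sumrN; congr (_ * _); apply: eq_bigr => k _.
  rewrite (is_D_antisym medium (Dgb k) (gG k)) opprK dot2C.
  by congr dot2; apply/funext => w; rewrite -colE mxE.
under eq_fun do rewrite e1.
have lim1 := Lu_weak _ H1phi _ _ _ _ uF phiG.
exact: (cvgB lim1 (appr_dot2 Lphi Lb phiG)).
Qed.

(** This is [x] plus the combination of the [F i] with the coordinates of [x]. Writing it over the
    basis reduces bilinear forms to the fields [evec i + F i], in which the homogenized entries are
    expressed. *)
Definition xi (x : 'cV[R]_d) (F : 'I_d -> Om -> 'cV[R]_d) : Om -> 'cV[R]_d :=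
  fun w => \sum_i x i ord0 *: (evec i + F i w).

Lemma L2v_shift (F : Om -> 'cV[R]_d) i : L2v F -> L2v (fun w => evec i + F w).
Proof. by move=> LF; apply: L2vD => //; exact: L2v_cst. Qed.

Lemma L2v_xi x (F : 'I_d -> Om -> 'cV[R]_d) : (forall i, L2v (F i)) -> L2v (xi x F).
Proof. by move=> LF; apply: L2v_sum => i; apply/L2vZ/L2v_shift. Qed.

Lemma dotv_xi (A : Om -> 'M[R]_d) x x' (F F' : 'I_d -> Om -> 'cV[R]_d) : bounded_mx A ->
  (forall i, L2v (F i)) -> (forall i, L2v (F' i)) ->
  dotv (xi x F) (fun w => A w *m xi x' F' w) =
  \sum_i x i ord0 * \sum_j x' j ord0 *
    dotv (fun w => evec i + F i w) (fun w => A w *m (evec j + F' j w)).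
Proof.
move=> bA LF LF'; have LeF i := L2v_shift i (LF i).
have LAeF j : L2v (fun w => A w *m (evec j + F' j w)).
  by apply: L2v_mulmx => //; exact: L2v_shift.
rewrite dotv_linl//; last by apply: L2v_mulmx => //; exact: L2v_xi.
apply: eq_bigr => i _; congr (_ * _).
have -> : (fun w => A w *m xi x' F' w) =
    (fun w => \sum_j x' j ord0 *: (A w *m (evec j + F' j w))).
  by apply/funext => w; rewrite mulmx_sumr; apply: eq_bigr => j _; rewrite scalemxAr.
by rewrite dotvC dotv_linl//; apply: eq_bigr => j _; rewrite dotvC.
Qed.

Lemma dotc_mxE (A : 'M[R]_d) x x' :
  dotc x (A *m x') = \sum_i x i ord0 * \sum_j x' j ord0 * A i j.
Proof.
rewrite dotcE; apply: eq_bigr => i _; rewrite mxE; congr (_ * _).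
by apply: eq_bigr => j _; rewrite mulrC.
Qed.

Lemma cvg_bilinear T (S : set_system T) {FS : Filter S}
    (q : 'I_d -> 'I_d -> T -> R) (l : 'I_d -> 'I_d -> R) (x x' : 'cV[R]_d) :
  (forall i j, q i j t @[t --> S] --> l i j) ->
  \sum_i x i ord0 * \sum_j x' j ord0 * q i j t @[t --> S] -->
  \sum_i x i ord0 * \sum_j x' j ord0 * l i j.
Proof.
move=> ql; apply: cvg_big => [|i _]; first exact: add_continuous.
apply: cvgMl_tmp; apply: cvg_big => [|j _]; first exact: add_continuous.
exact: cvgMl_tmp (ql i j).
Qed.

(** Separates the two limits: [n -> oo] at fixed [lam], with value [Q lam], then [lam -> 0]. The
    matrix [Q lam] is the same for all approximating sequences, since [ext_value] quantifies over
    them. *)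
Lemma homogenized_limit G GG y : bounded_mx (G ^~ y) ->
  homogenized mu tau sigmat u G GG ->
  exists Q : R -> 'M[R]_d,
    (forall lam f F, 0 < lam -> (forall i, appr (u lam i y) (f i) (F i)) ->
      forall x x', dotv (xi x (F ^~ n)) (fun w => G w y *m xi x' (F ^~ n) w)
        @[n --> \oo] --> dotc x (Q lam *m x')) /\
    forall x x', dotc x (Q lam *m x') @[lam --> (0 : R)^'+] -->
      dotc x (GG y *m x').
Proof.
move=> bG hG.
have /choice[E hE] : forall i, exists Ei : 'I_d -> R -> R, forall j,
    (forall lam, 0 < lam -> ext_value mu tau sigmat
      (formG mu (G ^~ y) (evec i) (evec j)) (u lam i y) (u lam j y) (Ei j lam)) /\
    Ei j lam @[lam --> (0 : R)^'+] --> GG y i j.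
  by move=> i; have /choice[Ei hEi] := hG y i; exists Ei.
exists (fun lam => \matrix_(i, j) E i j lam); split=> [lam f F l0 uF x x'|x x'].
  rewrite dotc_mxE; under eq_fun => n.
    rewrite dotv_xi//; try (by move=> i; exact: appr_L2v (uF i)).
    over.
  apply: cvg_bilinear => i j; rewrite mxE.
  exact: (hE i j).1 lam l0 _ _ _ _ (uF i) (uF j).
rewrite dotc_mxE; under eq_fun do rewrite dotc_mxE.
by apply: cvg_bilinear => i j; under eq_fun do rewrite mxE; exact: (hE i j).2.
Qed.

(* The corrector equation tested against u - phi bounds the energy of
   xi = x + Du by ((a + H) xi, zeta)_2 with zeta = x + D phi, up to O(lam);
   Young's inequality with t = 2 M^2 then absorbs the factor xi. *)
Lemma energy_upper lam y x f F phi Phi q : 0 < lam ->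
  (forall i, appr (u lam i y) (f i) (F i)) ->
  (forall i, core mu tau (phi i)) -> (forall i, is_grad mu tau (phi i) (Phi i)) ->
  dotv (xi x (F ^~ n)) (fun w => a w y *m xi x (F ^~ n) w) @[n --> \oo] --> q ->
  q <= 4 * M ^+ 3 * dotv (xi x Phi) (fun w => at_ w *m xi x Phi w) +
       lam * (4 * dot2 mu (fun w => \sum_i x i ord0 * phi i w)
                     (fun w => \sum_i x i ord0 * phi i w)).
Proof.
move=> l0 uF cphi gphi eq_lim.
set zeta := xi x Phi; set qz := dotv zeta _.
pose U w := \sum_i x i ord0 * u lam i y w.
pose P w := \sum_i x i ord0 * phi i w; rewrite -/P.
pose A w := a w y + H w y.
have bA : bounded_mx A by apply: bounded_mxD; [exact: bounded_a|exact: bounded_H].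
have LF i n : L2v (F i n) by exact: appr_L2v (uF i).
have LPhi i : L2v (Phi i) by exact: grad_L2v (gphi i).
have Lphi i : L2 mu (phi i) by exact: grad_L2 (gphi i).
have Lu i : L2 mu (u lam i y) by case: (corrector_H1 i y l0).
have H1phi i : H1 mu tau sigmat (phi i).
  split; first exact: Lphi.
  by exists (fun=> phi i), (fun=> Phi i); exact: appr_cst.
(* Half the form of [a + H] at [X] and [X - zeta], where [X] approximates [x + Du]. The constant
   vectors cancel in [X - zeta], leaving the gradient of an approximation of [U - P], so the weak
   equation gives the limit of [c n]. *)
pose c n := 2^-1 * dotv (xi x (F ^~ n)) (fun w => A w *m xi x (F ^~ n) w) -
  2^-1 * dotv zeta (fun w => A w *m xi x (F ^~ n) w).
have LU : L2 mu U by apply: L2_sum => i; exact: L2Z.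
have LP : L2 mu P by apply: L2_sum => i; exact: L2Z.
have dot2U (g : 'I_d -> Om -> R) : (forall i, L2 mu (g i)) ->
    dot2 mu (fun w => \sum_i x i ord0 * g i w) U =
    \sum_i x i ord0 * \sum_j x j ord0 * dot2 mu (u lam j y) (g i).
  move=> Lg; rewrite dot2_suml// => [|i]; last exact: L2Z.
  apply: eq_bigr => i _; rewrite dot2Zl//; congr (_ * _).
  rewrite dot2C dot2_suml// => [|j]; last exact: L2Z.
  by apply: eq_bigr => j _; rewrite dot2Zl.
have c_lim : c n @[n --> \oo] --> lam * (dot2 mu P U - dot2 mu U U).
  have -> : lam * (dot2 mu P U - dot2 mu U U) =
      \sum_i x i ord0 * \sum_j x j ord0 *
        (- (lam * dot2 mu (u lam j y) (u lam i y)) -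
         - (lam * dot2 mu (u lam j y) (phi i))).
    rewrite !dot2U// -sumrB mulr_sumr; apply: eq_bigr => i _.
    rewrite -mulrBr -sumrB mulrCA; congr (_ * _); rewrite mulr_sumr.
    by apply: eq_bigr => j _; ring.
  have cE n : c n = \sum_i x i ord0 * \sum_j x j ord0 *
      (2^-1 * dotv (F i n) (fun w => A w *m (evec j + F j n w)) -
       2^-1 * dotv (Phi i) (fun w => A w *m (evec j + F j n w))).
    rewrite /c /zeta !dotv_xi// !mulr_sumr -sumrB; apply: eq_bigr => i _.
    rewrite !(mulrCA 2^-1) -mulrBr; congr (_ * _).
    rewrite !mulr_sumr -sumrB; apply: eq_bigr => j _.
    rewrite !(mulrCA 2^-1) -mulrBr; congr (_ * _).
    have LA : L2v (fun w => A w *m (evec j + F j n w)).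
      by apply: L2v_mulmx => //; exact: L2v_shift.
    have Le : L2v (fun=> evec i) by exact: L2v_cst.
    by rewrite !dotvDl//; ring.
  under eq_fun do rewrite cE.
  apply: cvg_bilinear => i j.
  have lim1 := corrector_weak l0 (corrector_H1 i y l0) (uF j) (uF i).
  have lim2 := corrector_weak l0 (H1phi i) (uF j) (appr_cst (cphi i) (gphi i)).
  exact: cvgB lim1 lim2.
have c_ge n : 4^-1 * dotv (xi x (F ^~ n)) (fun w => a w y *m xi x (F ^~ n) w) -
    M ^+ 3 * qz <= c n.
  set X := xi x (F ^~ n).
  have LX : L2v X by exact: L2v_xi.
  have Lz : L2v zeta by exact: L2v_xi.
  have e1 : dotv X (fun w => A w *m X w) = dotv X (fun w => a w y *m X w).
    by apply: eq_Rintegral => w _; rewrite mulmxDl dotcDr H_dotc0 addr0.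
  (* For [t = 2 M^2], the coefficient [2 t^-1 M] of the [a~]-energy of [X] equals [M^-1]. As
     [a~ <= M a], that term is at most the [a]-energy, so a quarter of this energy survives in
     [c n]. *)
  have t0 : 0 < 2 * M ^+ 2 by rewrite mulr_gt0// exprn_gt0.
  have LAX : L2v (fun w => A w *m X w) by exact: L2v_mulmx.
  have LaX : L2v (fun w => a w y *m X w) by apply: L2v_mulmx => //; exact: bounded_a.
  have LtX : L2v (fun w => at_ w *m X w) by apply: L2v_mulmx => //; exact: bounded_at.
  have Ltz : L2v (fun w => at_ w *m zeta w) by apply: L2v_mulmx => //; exact: bounded_at.
  have h1 := le_dotv2 Lz LAX Lz Ltz LX LtX
    (fun w => aH_young w y (zeta w) (X w) t0).
  have h2 : 1 * dotv X (fun w => at_ w *m X w) <= M * dotv X (fun w => a w y *m X w)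
      + 0 * dotv X (fun w => a w y *m X w).
    by apply: le_dotv2 => // w; rewrite mul1r mul0r addr0 at_le_a.
  rewrite /c -/X e1; move: h1 h2; rewrite -/qz mul1r mul0r addr0.
  set e := dotv X (fun w => a w y *m X w).
  set e' := dotv X (fun w => at_ w *m X w).
  set k := dotv zeta _ => h1 h2.
  have tE : 2 * (2 * M ^+ 2)^-1 * M = M^-1 by field; rewrite gt_eqF.
  rewrite tE in h1.
  have Me : M^-1 * e' <= e by rewrite mulrC ler_pdivrMr// mulrC.
  by lra.
have lim : 4^-1 * q - M ^+ 3 * qz <= lam * (dot2 mu P U - dot2 mu U U).
  apply: (ler_cvg_to _ c_lim); last by apply: nearW; exact: c_ge.
  by apply: cvgB; [exact: cvgMl_tmp|exact: cvg_cst].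
(* Completing the square in [|U - P / 2|_2^2] removes [U]. The error is then [lam] times a quantity
   independent of [lam], with no uniform bound on the correctors. *)
have PU : dot2 mu P U - dot2 mu U U <= dot2 mu P P.
  have LUP : L2 mu (fun w => U w - 2^-1 * P w) by apply/L2B/L2Z.
  have := dot2_ge0 mu (fun w => U w - 2^-1 * P w).
  have LP2 := L2Z 2^-1 LP.
  rewrite dot2Bl// (dot2C mu U) (dot2C mu (fun w => 2^-1 * P w)) !dot2Bl//.
  rewrite !dot2Zl// (dot2C mu U (fun w => 2^-1 * P w)) dot2Zl//.
  rewrite (dot2C mu P (fun w => 2^-1 * P w)) dot2Zl//.
  by have := dot2_ge0 mu P; lra.
have := ler_wpM2l (ltW l0) PU.
by move: lim; lra.
Qed.

(** * Comparison, symmetry and kernel of the homogenized matrices *)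

Section limits.
Variables Abar Hbar : 'cV[R]_d -> 'M[R]_d.
Hypothesis Abar_lim : homogenized mu tau sigmat u a Abar.
Hypothesis Hbar_lim : homogenized mu tau sigmat u H Hbar.

(** Let [lam -> 0] in [energy_upper] with [phi] fixed. The right-hand side no longer depends on [y],
    which makes different points comparable. *)
Lemma homogenized_le_core y x phi Phi :
  (forall i, core mu tau (phi i)) -> (forall i, is_grad mu tau (phi i) (Phi i)) ->
  dotc x (Abar y *m x) <=
    4 * M ^+ 3 * dotv (xi x Phi) (fun w => at_ w *m xi x Phi w).
Proof.
move=> cphi gphi.
have [Q [Qn Ql]] := homogenized_limit (bounded_a y) Abar_lim.
set B := (X in _ <= X); set C := 4 * dot2 mu (fun w => \sum_i x i ord0 * phi i w)
                     (fun w => \sum_i x i ord0 * phi i w).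
have lim : B + lam * C @[lam --> (0 : R)^'+] --> B + 0 * C.
  apply: cvgD; first exact: cvg_cst.
  by apply: cvgMr_tmp; apply: cvg_at_right_filter; exact: cvg_id.
have -> : B = B + 0 * C by rewrite mul0r addr0.
apply: (ler_cvg_to (Ql x x) lim); near=> lam.
have l0 : 0 < lam by near: lam; exact: nbhs_right_gt.
have [f [F uF]] := corrector_appr y l0.
exact: (energy_upper l0 uF cphi gphi (Qn lam f F l0 uF x x)).
Unshelve. all: by end_near. Qed.

(** The previous bound at [y'] is tested with the approximations of the correctors at [y]; then
    [a~ <= M a] at [y] supplies the fourth factor [M]. Only the limits at [y] remain, in [n] and
    then in [lam]. *)
Lemma homogenized_compare y y' x :
  dotc x (Abar y' *m x) <= 4 * M ^+ 4 * dotc x (Abar y *m x).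
Proof.
have [Q [Qn Ql]] := homogenized_limit (bounded_a y) Abar_lim.
have lim : 4 * M ^+ 4 * dotc x (Q lam *m x) @[lam --> (0 : R)^'+] -->
    4 * M ^+ 4 * dotc x (Abar y *m x) by exact: cvgMl_tmp (Ql x x).
apply: (cvgr_to_ge lim); near=> lam.
have l0 : 0 < lam by near: lam; exact: nbhs_right_gt.
have [f [F uF]] := corrector_appr y l0.
have {}lim := Qn lam f F l0 uF x x.
apply: (cvgr_to_ge (cvgMl_tmp lim)); apply: nearW => n.
have cF i : core mu tau (f i n) by case: (uF i) => /(_ n)[].
have gF i : is_grad mu tau (f i n) (F i n) by case: (uF i) => /(_ n)[].
apply: le_trans (homogenized_le_core y' x cF gF) _.
rewrite (exprSr M 3) -!mulrA !ler_pM2l ?exprn_gt0//.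
have LX : L2v (xi x (F ^~ n)) by apply: L2v_xi => i; exact: grad_L2v (gF i).
have LtX : L2v (fun w => at_ w *m xi x (F ^~ n) w).
  by apply: L2v_mulmx => //; exact: bounded_at.
have LaX : L2v (fun w => a w y *m xi x (F ^~ n) w).
  by apply: L2v_mulmx => //; exact: bounded_a.
rewrite -dotvZl//; apply: le_dotv => //; first exact: L2vZ.
by move=> w; rewrite dotcZl at_le_a.
Unshelve. all: by end_near. Qed.

Lemma homogenized_psd y x : 0 <= dotc x (Abar y *m x).
Proof.
have [Q [Qn Ql]] := homogenized_limit (bounded_a y) Abar_lim.
apply: (cvgr_to_ge (Ql x x)); near=> lam.
have l0 : 0 < lam by near: lam; exact: nbhs_right_gt.
have [f [F uF]] := corrector_appr y l0.
apply: (cvgr_to_ge (Qn lam f F l0 uF x x)); apply: nearW => n.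
by apply: Rintegral_ge0 => w _; exact: mul_tr_psd.
Unshelve. all: by end_near. Qed.

Lemma homogenized_sym y : (Abar y)^T = Abar y.
Proof.
have [Q [Qn Ql]] := homogenized_limit (bounded_a y) Abar_lim.
have sym x x' : dotc x (Abar y *m x') = dotc x' (Abar y *m x).
  apply: (cvg_unique _ (Ql x x')) => //.
  apply: cvg_trans (Ql x' x); apply: near_eq_cvg; near=> lam.
  have l0 : 0 < lam by near: lam; exact: nbhs_right_gt.
  have [f [F uF]] := corrector_appr y l0.
  apply: (cvg_unique _ (Qn lam f F l0 uF x' x)) => //.
  apply: cvg_trans (Qn lam f F l0 uF x x').
  apply: near_eq_cvg; apply: nearW => n.
  by apply: eq_Rintegral => w _; rewrite dotc_mulmx mul_tr_sym dotcC.
by apply/matrixP => i j; rewrite mxE -!dotc_evec sym.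
Unshelve. all: by end_near. Qed.

(** One factor [M] comes from [|H| <= M a~], the other from [a~ <= M a]; the inequality survives
    both limits. *)
Lemma homogenized_young y x x' t : 0 < t ->
  2 * dotc x (Hbar y *m x') <=
    t * M ^+ 2 * dotc x (Abar y *m x) + t^-1 * M ^+ 2 * dotc x' (Abar y *m x').
Proof.
move=> t0.
have [Q [Qn Ql]] := homogenized_limit (bounded_a y) Abar_lim.
have [Q' [Qn' Ql']] := homogenized_limit (bounded_H y) Hbar_lim.
apply: (ler_cvg_to (cvgMl_tmp (Ql' x x'))
  (cvgD (cvgMl_tmp (Ql x x)) (cvgMl_tmp (Ql x' x')))); near=> lam.
have l0 : 0 < lam by near: lam; exact: nbhs_right_gt.
have [f [F uF]] := corrector_appr y l0.
apply: (ler_cvg_to (cvgMl_tmp (Qn' lam f F l0 uF x x'))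
  (cvgD (cvgMl_tmp (Qn lam f F l0 uF x x))
    (cvgMl_tmp (Qn lam f F l0 uF x' x')))).
apply: nearW => n.
have LX z : L2v (xi z (F ^~ n)) by apply: L2v_xi => i; exact: appr_L2v (uF i).
have LaX z : L2v (fun w => a w y *m xi z (F ^~ n) w).
  by apply: L2v_mulmx => //; exact: bounded_a.
have LHX z : L2v (fun w => H w y *m xi z (F ^~ n) w).
  by apply: L2v_mulmx => //; exact: bounded_H.
apply: le_dotv2 => // w; apply: le_trans (H_young w y _ _ t0) _.
by rewrite expr2 -!mulrA lerD// !ler_pM2l ?invr_gt0// at_le_a.
Unshelve. all: by end_near. Qed.

Lemma kerc_homogenized y y' : kerc (Abar y) `<=` kerc (Abar y').
Proof.
move=> x /= Ax; apply: psd_ker; [exact: homogenized_sym|exact: homogenized_psd|].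
apply/eqP; rewrite eq_le homogenized_psd andbT.
by apply: le_trans (homogenized_compare y y' x) _; rewrite Ax dotc0r mulr0.
Qed.

(** In Young's inequality for [z = Hbar x] and [x], the [t^-1] term vanishes on the kernel; then
    [t -> 0] gives [|z|^2 <= 0]. *)
Lemma homogenized_H_kerc y x : kerc (Abar y) x -> Hbar y *m x = 0.
Proof.
move=> /= Ax; apply: dotc_eq0; apply/eqP; rewrite eq_le dotc_ge0 andbT.
set z := Hbar y *m x.
apply: (@ler_small _ _ _ (2^-1 * (M ^+ 2 * dotc z (Abar y *m z)))) => t t0.
have := homogenized_young y z x t0; rewrite Ax dotc0r mulr0 addr0 -/z.
by move: (dotc z z) (dotc z _) => p q; lra.
Qed.

End limits.

End homogenization.

(** * The drift and the stochastic integral *)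

(** For each [i] the combination of the [c i j] with the coordinates of [k] is [expR (- 2 V)] times
    an entry of [(A + N) k], hence identically zero. Its derivative is zero too, and
    differentiability of each [c i j] allows the derivative to be taken termwise. *)
Lemma dotc_drift (R : realType) (d : nat) (V : 'cV[R]_d -> R)
    (A N : 'cV[R]_d -> 'M[R]_d) (B : 'cV[R]_d -> 'cV[R]_d) k y :
  homogenized_drift V A N B -> (forall z, (A z + N z) *m k = 0) ->
  dotc (B y) k = 0.
Proof.
move=> [dc BE] ANk.
pose c i j z : R := expR (- 2 * V z) * (A z + N z) i j.
have D0 i : \sum_j k j ord0 * 'D_(evec i) (c i j) y = 0.
  have -> : \sum_j k j ord0 * 'D_(evec i) (c i j) y =
      'D_(evec i) (\sum_j (k j ord0 \*: (c i j : _ -> R^o))) y.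
    rewrite derive_sum => [|j]; last exact/derivableZ/dc.
    by apply: eq_bigr => j _; rewrite deriveZ//; exact: dc.
  rewrite (_ : \sum_j _ = cst 0) ?derive_cst//; apply/funext => z.
  rewrite fct_sumE /=; transitivity (expR (- 2 * V z) * ((A z + N z) *m k) i ord0).
    rewrite mxE mulr_sumr; apply: eq_bigr => j _.
    by rewrite /c /GRing.scale /=; ring.
  by rewrite ANk mxE mulr0.
rewrite dotcE; under eq_bigr => j _ do rewrite BE -[_ * _ * k _ _]mulrA mulr_suml.
rewrite -mulr_sumr exchange_big big1 ?mulr0// => i _.
by rewrite -[RHS](D0 i); apply: eq_bigr => j _; rewrite mulrC.
Qed.

(** Induction on the number of steps of length [eta = delta / 2]: the point [t] is appended to a
    partition ending at [max 0 (t - eta)]. Halving [delta] makes the mesh bound strict. *)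
Lemma itv_partition_mesh (R : realType) (t delta : R) : 0 <= t -> 0 < delta ->
  exists2 s, itv_partition 0 t s & path (fun r r' => r' - r < delta) 0 s.
Proof.
move=> t0 delta0; pose eta := delta / 2.
have eta0 : 0 < eta by rewrite divr_gt0.
have eta_lt : eta < delta by rewrite ltr_pdivrMr// ltr_pMr// ltr1n.
have [n tn] : exists n, t <= n%:R * eta.
  exists (Num.trunc (t / eta)).+1; rewrite -ler_pdivrMr// ltW//.
  by case/andP: (truncn_itv (divr_ge0 t0 (ltW eta0))).
elim: n t t0 tn => [|n IH] t t0 tn.
  have -> : t = 0 by apply/eqP; rewrite eq_le t0 andbT -[leRHS](mul0r eta).
  by exists [::] => //; split.
have [te|te] := leP t 0.
  have -> : t = 0 by apply/eqP; rewrite eq_le t0 te.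
  by exists [::] => //; split.
pose t' := Num.max 0 (t - eta).
have [||s [s1 /eqP s2] s3] := IH t'.
- by rewrite le_max lexx.
- by rewrite ge_max mulr_ge0 ?(ltW eta0)//= lerBlDr (le_trans tn)// -natr1 mulrDl mul1r.
exists (rcons s t); first split.
- by rewrite rcons_path s1 s2 /= /t' gt_max te ltrBlDr ltrDl.
- by rewrite last_rcons.
rewrite rcons_path s3 s2 /= ltrBlDr -ltrBlDl (@lt_le_trans _ _ (t - eta))//.
  by rewrite ltrD2l ltrN2.
by rewrite le_max lexx orbT.
Qed.

(** * Orthogonality of the stochastic integral to a fixed vector *)

Section ito.
Context {R : realType} {d : nat} {dT : measure_display} {T : measurableType dT}.
Variables (P : probability T R) (Ft : R -> set (set T)).
Variables (Z : R -> T -> 'M[R]_d) (W I : R -> T -> 'cV[R]_d) (k : 'cV[R]_d).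
Hypotheses (filt : filtration Ft) (bm : brownian P Ft W).
Hypothesis itoI : ito_integral P Ft W Z I.
Hypothesis Zk : forall r w v, dotc (Z r w *m v) k = 0.

Lemma adapted_measurable m n (Y : R -> T -> 'M[R]_(m, n)) t i j :
  adapted Ft Y -> 0 <= t -> measurable_fun [set: T] (fun w => Y t w i j).
Proof.
move=> aY t0 _ B mB; rewrite setTI.
by case: filt => _ + _; apply; [exact: t0|exact: aY].
Qed.

Lemma dotc_ito_sum r s w : dotc (ito_sum Z W r s w) k = 0.
Proof.
by elim: s r => [|r' s IH] r /=; rewrite ?dotc0l// dotcDl IH Zk addr0.
Qed.

Lemma measurable_ito_sum r s i : 0 <= r -> path <%R r s ->
  measurable_fun [set: T] (fun w => ito_sum Z W r s w i ord0).
Proof.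
case: itoI => -[aZ _] _ _; case: bm => aW _ _ _.
elim: s r => [|r' s IH] r r0 /=.
  by move=> _; under eq_fun do rewrite mxE; exact: measurable_cst.
move=> /andP[rr' ps]; have r'0 : 0 <= r' by rewrite (le_trans r0)// ltW.
under eq_fun do rewrite mxE; apply: measurable_funD; last exact: IH.
under eq_fun do rewrite mxE; apply: measurable_sum => j.
apply: measurable_funM; first exact: adapted_measurable.
under eq_fun do rewrite !mxE; apply: measurable_funB; exact: adapted_measurable.
Qed.

(** Squaring, legitimate since [e > 0], turns the event into a level set of a polynomial in the
    coordinates. *)
Lemma measurable_enorm_gt (Y : T -> 'cV[R]_d) e : 0 < e ->
  (forall i, measurable_fun [set: T] (fun w => Y w i ord0)) ->
  measurable [set w | e < enorm (Y w)].
Proof.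
move=> e0 mY.
have -> : [set w | e < enorm (Y w)] =
    (fun w => \sum_i Y w i ord0 * Y w i ord0) @^-1` `]e ^+ 2, +oo[.
  apply/seteqP; split=> w /=; rewrite in_itv/= andbT -dotcE -sqr_enorm;
    by rewrite ltr_pXn2r// ?nnegrE ?sqrtr_ge0// ltW.
rewrite -[X in measurable X]setTI; apply: measurable_sum => // i.
exact: measurable_funM.
Qed.

(** Every left-point sum is orthogonal to [k], so a large [|(I, k)|] forces [I] to be far from every
    such sum. The definition of the integral makes this probability arbitrarily small. *)
Lemma ito_dotc0 t : 0 <= t -> \forall w \ae P, dotc (I t w) k = 0.
Proof.
move=> t0; case: (itoI) => _ [aI _] Ilim.
have mI i : measurable_fun [set: T] (fun w => I t w i ord0).
  exact: adapted_measurable.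
have mIk : measurable_fun [set: T] (fun w => dotc (I t w) k).
  under eq_fun do rewrite dotcE.
  by apply: measurable_sum => i; exact: measurable_funM.
(* The added 1 keeps [C] positive when [k = 0]. *)
pose C := \sum_i `|k i ord0| + 1.
have C0 : 0 < C by rewrite ltr_wpDl// sumr_ge0.
pose E n := [set w | n.+1%:R^-1 * C < `|dotc (I t w) k|].
have mE n : measurable (E n).
  have -> : E n = (fun w => `|dotc (I t w) k|) @^-1` `]n.+1%:R^-1 * C, +oo[.
    by apply/seteqP; split=> w /=; rewrite in_itv/= andbT.
  have mN : measurable_fun [set: T] (fun w => `|dotc (I t w) k|).
    exact: measurableT_comp.
  by rewrite -[X in measurable X]setTI; apply: mN => //; exact: measurable_itv.
have E0 n : P (E n) = 0%E.
  apply/eqP; rewrite eq_le measure_ge0 andbT; apply/lee_addgt0Pr => eta eta0.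
  rewrite add0e; have e0 : 0 < n.+1%:R^-1 :> R by rewrite invr_gt0.
  have [delta delta0 hdelta] := Ilim t _ eta t0 e0 eta0.
  have [s s1 s2] := itv_partition_mesh t0 delta0.
  apply: le_trans (hdelta s s1 s2); apply: le_measure; rewrite ?inE//.
    apply: measurable_enorm_gt => // i; under eq_fun do rewrite !mxE.
    by apply: measurable_funB => //; apply: measurable_ito_sum => //; case: s1.
  move=> w /= lt_n; rewrite -(ltr_pM2r C0); apply: lt_le_trans lt_n _.
  have -> : dotc (I t w) k = dotc (I t w - ito_sum Z W 0 s w) k.
    by rewrite dotcDl dotcNl dotc_ito_sum subr0.
  apply: le_trans (norm_dotc_le _ _) _.
  by rewrite ler_wpM2l ?sqrtr_ge0// lerDl.
have : P.-negligible (\bigcup_n E n).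
  by apply: negligible_bigcup => n; apply/negligibleP; [exact: mE|exact: E0].
apply: negligibleS => w /= /eqP Ik; have Ik0 : 0 < `|dotc (I t w) k| / C.
  by rewrite divr_gt0// normr_gt0.
have [n _ hn] := near_infty_natSinv_lt (PosNum Ik0).
exists n => //=; rewrite /E /= -ltr_pdivlMr//.
by have := hn n (leqnn n).
Qed.

(* Continuity extends the almost sure identity from the countable set of the
   times m / (n + 1) to all times. *)
Lemma ito_dotc0_all : \forall w \ae P, forall t, 0 <= t -> dotc (I t w) k = 0.
Proof.
have [_ [_ cI] _] := itoI.
have rat0 : \forall w \ae P, forall n m : nat, dotc (I (m%:R / n.+1%:R) w) k = 0.
  by apply: ae_foralln => n; apply: ae_foralln => m; apply: ito_dotc0.
apply: filterS2 cI rat0 => w /subspace_continuousP cw w0 t t0.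
(* Rounding [t] down to the grid of step [1 / (n + 1)] gives nonnegative times converging to [t],
   inside the half-line where the path is continuous. *)
pose s n : R := (Num.trunc (t * n.+1%:R))%:R / n.+1%:R.
have st : s n @[n --> \oo] --> t.
  have h0 : t - harmonic n @[n --> \oo] --> t.
    by rewrite -[X in _ --> X]subr0; apply: cvgB; [exact: cvg_cst|exact: cvg_harmonic].
  apply: (squeeze_cvgr _ h0 (cvg_cst t)); apply: nearW => n.
  have n0 : 0 < n.+1%:R :> R by [].
  have /andP[tl tr] := truncn_itv (mulr_ge0 t0 (ltW n0)).
  rewrite /s /= ler_pdivrMr// tl andbT /harmonic.
  rewrite lerBlDr -[X in _ + X]div1r -mulrDl ler_pdivlMr//.
  by rewrite natr1 ltW.
have sw : s n @[n --> \oo] --> within [set t | 0 <= t] (nbhs t).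
  move=> B /= wB; have := st _ wB; rewrite /nbhs/= => h.
  by near=> n; apply: (near h) => //; rewrite divr_ge0.
have Isw : I (s n) w @[n --> \oo] --> I t w.
  by apply: (@cvg_comp _ _ _ s (I ^~ w) _ _ _ sw); exact: cw.
have lim : dotc (I (s n) w) k @[n --> \oo] --> dotc (I t w) k.
  rewrite dotcE; under eq_fun do rewrite dotcE.
  apply: cvg_big => [|i _]; first exact: add_continuous.
  apply: cvgMr_tmp.
  by apply: (@cvg_comp _ _ _ _ (fun v : 'cV[R]_d => v i ord0) _ _ _ Isw);
    exact: coord_continuous.
apply: (cvg_unique _ lim) => //; rewrite (_ : (fun n => _) = fun=> 0).
  exact: cvg_cst.
by apply/funext => n; exact: w0.
Unshelve. all: by end_near. Qed.

End ito.

Theorem proposition3p2 (R : realType) (d : nat) (hd : (0 < d)%N)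
    (dO : measure_display) (Om : measurableType dO) (mu : probability Om R)
    (tau : 'cV[R]_d -> Om -> Om)
    (sigma H : Om -> 'cV[R]_d -> 'M[R]_d) (sigmat : Om -> 'M[R]_d)
    (V : 'cV[R]_d -> R) (Lam M : R)
    (u : R -> 'I_d -> 'cV[R]_d -> Om -> R)
    (Abar Hbar : 'cV[R]_d -> 'M[R]_d) (Bbar : 'cV[R]_d -> 'cV[R]_d) :
  0 < Lam -> 0 < M ->
  random_medium mu tau ->
  measurable_coefficients sigma H sigmat V ->
  (forall w y, (H w y)^T = - H w y) ->
  regularity tau sigma H sigmat Lam V ->
  control sigma H sigmat M V ->
  ergodic_form mu tau sigmat ->
  (forall lam i y, 0 < lam ->
     corrector mu tau sigma H sigmat lam i y (u lam i y)) ->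
  homogenized mu tau sigmat u (amx sigma) Abar ->
  homogenized mu tau sigmat u H Hbar ->
  homogenized_drift V Abar Hbar Bbar ->
  exists K : set 'cV[R]_d,
    [/\ forall y, kerc (Abar y) = K,
        forall y, orthc K (Bbar y),
        exists2 alpha : R, 0 < alpha & forall y x, orthc K x ->
          alpha^-1 * enorm x ^+ 2 <= dotc x (Abar y *m x) <=
          alpha * enorm x ^+ 2
      & forall S : 'cV[R]_d -> 'M[R]_d,
          (forall y, is_sqrtmx (Abar y) (S y)) ->
          (forall y z, orthc K (S y *m z)) /\
          (forall (dT : measure_display) (T : measurableType dT)
             (P : probability T R) (Ft : R -> set (set T))
             (W : R -> T -> 'cV[R]_d) (x : 'cV[R]_d)
             (X : R -> T -> 'cV[R]_d),
             filtration Ft -> brownian P Ft W ->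
             sde_solution P Ft W Bbar S x X ->
             \forall w \ae P, forall t : R, 0 <= t ->
               orthc K (X t w - x))].
Proof.
move=> _ M0 medium mc Ha reg ctrl _ uc hA hH hB.
have Asym y := homogenized_sym medium mc reg uc hA y.
have Apsd y x := homogenized_psd medium mc reg uc hA y x.
have Acmp y y' x :=
  homogenized_compare hd M0 medium mc Ha reg ctrl uc hA y y' x.
have kerS y y' := kerc_homogenized hd M0 medium mc Ha reg ctrl uc hA (y := y) y'.
pose K := kerc (Abar 0).
have kerE y : kerc (Abar y) = K by apply/seteqP; split; exact: kerS.
have AK y k : K k -> Abar y *m k = 0 by rewrite -(kerE y).
have BK y : orthc K (Bbar y).
  move=> k Kk; apply: dotc_drift hB _ => z; rewrite mulmxDl AK// add0r.
  apply: (homogenized_H_kerc M0 medium mc Ha reg ctrl uc hA hH).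
  by rewrite kerE.
exists K; split=> [//|//||S sqrtS].
  (* Ellipticity is established at the point 0, with [c] for the lower bound and [C] for the upper
     one. The comparison carries it to every [y] at the cost of [4 M^4], and [c + C] serves both
     sides. *)
  have [c c0 cP] := psd_orthc_ker_ge (Asym 0) (Apsd 0).
  pose C := \sum_i \sum_j `|Abar 0 i j|.
  have C0 : 0 <= C by rewrite sumr_ge0// => i _; rewrite sumr_ge0.
  have M40 : 0 < 4 * M ^+ 4 by rewrite mulr_gt0// exprn_gt0.
  have a0 : 0 < 4 * M ^+ 4 * (c + C) by rewrite mulr_gt0// ltr_wpDr.
  exists (4 * M ^+ 4 * (c + C)) => // y x Kx; apply/andP; split.
    rewrite mulrC ler_pdivrMr// mulrC (le_trans (cP x Kx))//.
    rewrite (le_trans (ler_wpM2l (ltW c0) (Acmp y 0 x)))//.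
    rewrite mulrA (mulrC c) ler_wpM2r//; last by rewrite ler_pM2l// lerDl.
  rewrite (le_trans (Acmp 0 y x))// -[leRHS]mulrA ler_pM2l//.
  rewrite (le_trans (dotc_mx_le _ _))// -/C ler_wpM2r ?sqr_ge0//.
  by rewrite lerDr ltW.
(* For [k] in [K], [|S k|^2 = (k, S S k) = (k, Abar k) = 0]; since [S] is symmetric, its range is
   orthogonal to [K]. *)
have SK y z : orthc K (S y *m z).
  move=> k Kk; have [sS _ SS] := sqrtS y.
  have Sk : S y *m k = 0.
    by apply: dotc_eq0; rewrite dotc_mulmx sS mulmxA SS AK// dotc0l.
  by rewrite dotcC dotc_mulmx sS Sk dotc0l.
split=> // dT T P Ft W x X filt bm [aX cX [I [itoI eqn]]].
(* Finitely many test vectors keep the exceptional null sets under control. *)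
pose k j := col j (cokermx (Abar 0)).
have Ik : \forall w \ae P, forall j t, 0 <= t -> dotc (I t w) (k j) = 0.
  apply: filter_forall => j; apply: (ito_dotc0_all filt bm itoI) => r w v.
  by apply: SK; exact: kerc_cokermx.
apply: filterS2 eqn Ik => w eqw Iw t t0; apply/orthc_kercP => j.
have [iB ->] := eqw t t0.
rewrite -[x + _ + _]addrA [x + _]addrC addrK dotcDl Iw// addr0 dotcE.
have iBk i : lebesgue_measure.-integrable `[0, t]
    (EFin \o (fun r : R => Bbar (X r w) i ord0 * k j i ord0)).
  exact: (integrableZr _ _ (iB i)).
under eq_bigr => i _ do rewrite mxE -RintegralZr//.
rewrite -Rintegral_sum//.
rewrite -[RHS](mul0r (fine (lebesgue_measure `[0, t]))) -Rintegral_cst//.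
by apply: eq_Rintegral => r _; rewrite -dotcE; apply/BK/kerc_cokermx.
Qed.
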